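(* Let $v$ be a vertex of degree $d$ in a graph $G$. Then $\sigma_v(G)$ is $d$-polytopal if and only if $G$ is $d$-polytopal.
   Context: Graphs are simple. A graph is $d$-polytopal if it is isomorphic to the graph (vertices and edges) of a $d$-dimensional polytope. If $v$ is a vertex of degree $d$ of a graph $G$, the star-clique operation at $v$ replaces the vertex $v$ by a $d$-clique $K$ (a complete graph on $d$ new vertices), and assigns one edge incident to $v$ to each vertex of $K$ (i.e. if $u_1,\dots,u_d$ are the neighbors of $v$ and $v_1,\dots,v_d$ are the vertices of $K$, each edge $\{v,u_i\}$ is replaced by $\{v_i,u_i\}$). The resulting graph is denoted $\sigma_v(G)$; it has $d-1$ more vertices and $\binom{d}{2}$ more edges than $G$. *)

(* Defs.v *)
From HB Require Import structures.
From mathcomp Require Import all_boot all_order all_algebra.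
From mathcomp Require Import boolp classical_sets functions cardinality reals.

Set Implicit Arguments.
Unset Strict Implicit.
Unset Printing Implicit Defensive.

Import Order.TTheory GRing.Theory Num.Theory.

Local Open Scope classical_set_scope.
Local Open Scope card_scope.
Local Open Scope ring_scope.

(** Simple graphs. The vertex type is not required to be finite. *)

Record sgraph := SGraph {
  vertex :> Type;
  adj : vertex -> vertex -> Prop;
  adj_sym : forall x y, adj x y -> adj y x;
  adj_irrefl : forall x, ~ adj x x }.

Definition isograph (G H : sgraph) : Prop :=
  exists2 f : G -> H, bijective f & forall x y, adj x y <-> adj (f x) (f y).

Definition neighbors (G : sgraph) (v : G) : set G := [set u | adj v u].

Definition has_degree (G : sgraph) (v : G) (d : nat) : Prop :=
  neighbors v #= `I_d.

(** The star-clique operation. The vertices of the clique K replacing v are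
    labelled by the neighbors of v: [inr u] is the vertex of K that receives
    the edge from v to u. Hence K has as many vertices as the degree of v. *)

Section StarClique.
Variables (G : sgraph) (v : G).

Definition star_clique_vertex : Type :=
  (set_type [set~ v] + set_type (neighbors v))%type.

Definition star_clique_adj (x y : star_clique_vertex) : Prop :=
  match x, y with
  | inl a, inl b => adj (val a) (val b)
  | inl a, inr u => val a = val u
  | inr u, inl a => val a = val u
  | inr u, inr w => u <> w
  end.

Lemma star_clique_sym x y : star_clique_adj x y -> star_clique_adj y x.
Proof.
by case: x y => [a|u] [b|w] //=; [exact: adj_sym | move=> uw wu; exact: uw].
Qed.

Lemma star_clique_irrefl x : ~ star_clique_adj x x.
Proof. by case: x => [a|u] /=; [exact: adj_irrefl | exact]. Qed.

Definition star_clique : sgraph := SGraph star_clique_sym star_clique_irrefl.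

End StarClique.

Section Polytopes.
Variables (R : realType) (n : nat).
Implicit Types (A P F : set 'rV[R]_n) (x y : 'rV[R]_n) (d : nat).

Definition conv_hull A : set 'rV[R]_n :=
  [set x | exists (k : nat) (p : 'I_k -> 'rV[R]_n) (a : 'I_k -> R),
     [/\ forall i, A (p i), forall i, 0 <= a i, \sum_(i < k) a i = 1 &
         x = \sum_(i < k) a i *: p i]].

Definition aff_hull A : set 'rV[R]_n :=
  [set x | exists (k : nat) (p : 'I_k -> 'rV[R]_n) (a : 'I_k -> R),
     [/\ forall i, A (p i), \sum_(i < k) a i = 1 &
         x = \sum_(i < k) a i *: p i]].

(** The affine hull of A is a translate of a d-dimensional linear subspace;
    the empty set has no dimension in this sense. *)
Definition has_dim A d : Prop :=
  exists (x0 : 'rV[R]_n) (U : {vspace 'rV[R]_n}),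
    aff_hull A = [set x0 + u | u in [set u | u \in U]] /\ \dim U = d.

Definition polytope P : Prop :=
  exists2 A : set 'rV[R]_n, finite_set A & P = conv_hull A.

(** F is cut out of P by the equality case of a valid linear inequality; the
    empty face and P itself are obtained with c = 0. *)
Definition face P F : Prop :=
  exists (c : 'cV[R]_n) (b : R),
    (forall x, P x -> (x *m c) 0 0 <= b) /\
    F = P `&` [set x | (x *m c) 0 0 = b].

Definition vertices P : set 'rV[R]_n := [set x | face P [set x]].

Definition edge P F : Prop := face P F /\ has_dim F 1.

Definition polytope_adj P (x y : set_type (vertices P)) : Prop :=
  x <> y /\ exists F, [/\ edge P F, F (val x) & F (val y)].

Lemma polytope_adj_sym P (x y : set_type (vertices P)) :
  polytope_adj x y -> polytope_adj y x.
Proof.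
by move=> [xy [F [eF Fx Fy]]]; split; [move=> yx; exact: xy | exists F].
Qed.

Lemma polytope_adj_irrefl P (x : set_type (vertices P)) : ~ polytope_adj x x.
Proof. by case. Qed.

Definition polytope_graph P : sgraph :=
  SGraph (@polytope_adj_sym P) (@polytope_adj_irrefl P).

End Polytopes.

(** The dimension n of the ambient space is arbitrary: the polytope only has to
    have dimension d. *)
Definition polytopal (R : realType) (d : nat) (G : sgraph) : Prop :=
  exists (n : nat) (P : set 'rV[R]_n),
    [/\ polytope P, has_dim P d & isograph G (polytope_graph P)].

(* Main.v *)
Require Import Defs.
From mathcomp Require Import all_boot all_order all_algebra reals.
From mathcomp Require Import boolp classical_sets cardinality.
From mathcomp Require Import ring lra.

Set Implicit Arguments.
Unset Strict Implicit.
Unset Printing Implicit Defensive.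

Import Order.TTheory GRing.Theory Num.Theory.

Local Open Scope classical_set_scope.
Local Open Scope card_scope.
Local Open Scope ring_scope.

(** Truncating a polytope at a simple vertex v replaces v by a simplex, one
    vertex on each edge through v, and this acts on the graph as the star-clique
    operation. Conversely, if the graph of a polytope is a star-clique, the
    clique spans a facet that is a simplex with simple vertices, and the d
    adjacent facets have a common point; putting that point in place of the
    clique undoes the truncation. The difficulty is that the common point may
    lie at infinity or on the wrong side of the facet, so that a projective
    transformation is needed first.

    Homogenization makes these transformations invisible. A point x becomes the
    vector (1, x), a polytope of dimension d becomes the cone spanned by
    finitely many vectors of R^(d+1), and its faces are the zero sets of the
    linear functionals that are nonnegative on these vectors ([exposes]). Only
    the existence of some functional that is positive on all the vectors is
    kept, and positive rescalings of the vectors are allowed. The predicate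
    [realizes] expresses that vectors indexed by the vertices of a graph form
    such a configuration whose two-element faces are the edges, and
    [polytopal_realizes] shows that having such vectors is the same as being
    d-polytopal.

    The combinatorial engine is the principle of the simplex algorithm
    ([local_global], [cone_ge0]): a functional that vanishes at v and is
    nonnegative at the neighbors of v is nonnegative everywhere, and likewise
    inside any face. When v has at most d neighbors, it follows by counting
    dimensions that v and its neighbors form a basis ([simple_values]), so
    functionals can be prescribed freely on them.

    Truncation: with h negative at v and positive at all other vertices, v is
    replaced by the points of its edges where h vanishes
    ([truncation_realizes]).

    Converse, for d > 1: let K be the clique, and for u in K let the foot of u be
    its neighbor outside K. The clique is the zero set of some functional h
    ([clique_exposed]). For each u in K there is a functional e u exposing a
    facet that contains the rest of K and, which is the main point, the feet of
    all the vertices of K other than u ([clique_facet]). The e u and h form a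
    basis of the functionals, and the vector [apex], on which the e u vanish and
    h is -1, lies on the line through each u and its foot ([apex_line]).
    Replacing K by [apex] gives the wanted vectors
    ([untruncation_realizes]). For d = 1 the two graphs are isomorphic. *)

(** * Subsets and finite types *)

Definition elem (T : Type) (A : set T) x (Ax : A x) : set_type A :=
  exist (fun x => x \in A) x (mem_set Ax).

Lemma card_enum (T : Type) (A : set T) (n : nat) : A #= `I_n ->
  exists g : 'I_n -> T,
    [/\ forall i, A (g i), injective g & forall x, A x -> exists i, g i = x].
Proof.
move=> /card_set_bijP[f [fA finj fsurj]].
have /choice[g gP] (i : 'I_n) : exists x, A x /\ f x = i.
  by have [x Ax fx] := fsurj i (ltn_ord i); exists x.
exists g; split=> [i|i j gij|x Ax]; first by have [] := gP i.
  by apply: val_inj; rewrite /= -(gP i).2 -(gP j).2 gij.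
exists (Ordinal (fA x Ax)); have [Ag fg] := gP (Ordinal (fA x Ax)).
by apply: finj; rewrite ?inE.
Qed.

Lemma finite_enum (T : Type) : finite_set [set: T] ->
  exists n (g : 'I_n -> T), forall x, exists i, g i = x.
Proof.
move=> /finite_setP[n /card_enum[g [_ _ gsurj]]].
by exists n, g => x; apply: gsurj.
Qed.

Lemma finite_set_type T (A : set T) : finite_set A -> finite_set [set: set_type A].
Proof.
by move=> finA; apply: (card_le_finite _ finA); rewrite (card_le_eql (card_setT A)).
Qed.

Lemma finite_argmin (R : realType) (T : Type) (P : set T) (f : T -> R) x :
  finite_set [set: T] -> P x ->
  exists y, P y /\ forall z, P z -> f y <= f z.
Proof.
move=> /finite_enum[n [g gsurj]] Px.
have [i0 gi0] := gsurj x.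
have Pi0 : `[< P (g i0) >] by apply/asboolP; rewrite gi0.
case: (@Order.TotalTheory.arg_minP _ R _ i0 (fun i => `[< P (g i) >])
  (fun i => f (g i)) Pi0) => i /asboolP Pi min_i.
exists (g i); split=> // z Pz; have [j gj] := gsurj z.
by rewrite -gj; apply: min_i; apply/asboolP; rewrite gj.
Qed.

Lemma finite_bound (R : realType) (T : Type) (f : T -> R) :
  finite_set [set: T] -> exists M, 0 < M /\ forall x, f x < M.
Proof.
move=> fin; have [[x _]|T0] := pselect (exists x : T, True).
  have [y [_ maxy]] := @finite_argmin _ _ setT (fun x => - f x) x fin I.
  exists (`|f y| + 1); split=> [|z].
    by rewrite ltr_pwDr.
  rewrite ltr_pwDr// (le_trans _ (ler_norm _))//.
  by rewrite -lerN2 maxy.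
by exists 1; split=> // x; case: T0; exists x.
Qed.

Lemma finite_minimal_set (T : Type) (P : set T -> Prop) F :
  finite_set [set: T] -> P F ->
  exists F', [/\ F' `<=` F, P F' & forall F'', F'' `<=` F' -> P F'' -> F'' = F'].
Proof.
move=> /finite_enum[n [g gsurj]].
pose size A := #|[pred i : 'I_n | `[< A (g i) >]]|.
have [k] := ubnP (size F); elim: k F => // k IH F ltF PF.
have [[F'' [sub PF'' ne]]|min] :=
  pselect (exists F'', [/\ F'' `<=` F, P F'' & F'' <> F]); last first.
  exists F; split=> // F'' sub PF''; apply: contrapT => ne.
  by apply: min; exists F''.
have [|F' [sub' PF' min']] := IH F'' _ PF''.
  rewrite -ltnS (leq_trans _ ltF)// ltnS proper_card//.
  apply/fintype.properP; split.
    by apply/fintype.subsetP => i; rewrite !inE => /sub.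
  have [x [Fx nFx]] : exists x, F x /\ ~ F'' x.
    apply: contrapT => nex; apply: ne; apply/seteqP; split=> // x Fx.
    by apply: contrapT => nFx; apply: nex; exists x.
  have [i gi] := gsurj x.
  by exists i; rewrite inE gi//=; apply/asboolP.
by exists F'; split=> // x /sub' /sub.
Qed.

(** * Vectors and functionals *)

Section Pairing.
Variables (R : realType) (m : nat).
Implicit Types (x y : 'rV[R]_m) (c e : 'cV[R]_m).

Definition dot x c : R := (x *m c) 0 0.

Lemma dotDr x c e : dot x (c + e) = dot x c + dot x e.
Proof. by rewrite /dot mulmxDr mxE. Qed.

Lemma dotZr x a c : dot x (a *: c) = a * dot x c.
Proof. by rewrite /dot -scalemxAr mxE. Qed.

Lemma dotNr x c : dot x (- c) = - dot x c.
Proof. by rewrite -scaleN1r dotZr mulN1r. Qed.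

Lemma dotBr x c e : dot x (c - e) = dot x c - dot x e.
Proof. by rewrite dotDr dotNr. Qed.

Lemma dot0r x : dot x 0 = 0.
Proof. by rewrite /dot mulmx0 mxE. Qed.

Lemma dot_sumr x I (r : seq I) (P : pred I) (F : I -> 'cV[R]_m) :
  dot x (\sum_(i <- r | P i) F i) = \sum_(i <- r | P i) dot x (F i).
Proof. by rewrite /dot mulmx_sumr summxE. Qed.

Lemma dotDl x y c : dot (x + y) c = dot x c + dot y c.
Proof. by rewrite /dot mulmxDl mxE. Qed.

Lemma dotZl a x c : dot (a *: x) c = a * dot x c.
Proof. by rewrite /dot -scalemxAl mxE. Qed.

Lemma dotBl x y c : dot (x - y) c = dot x c - dot y c.
Proof. by rewrite -scaleN1r dotDl dotZl mulN1r. Qed.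

Lemma dot_suml I (r : seq I) (P : pred I) (F : I -> 'rV[R]_m) c :
  dot (\sum_(i <- r | P i) F i) c = \sum_(i <- r | P i) dot (F i) c.
Proof. by rewrite /dot mulmx_suml summxE. Qed.

End Pairing.

Lemma dot_mulmx (R : realType) m n (x : 'rV[R]_m) (Q : 'M_(m, n)) c :
  dot (x *m Q) c = dot x (Q *m c).
Proof. by rewrite /dot mulmxA. Qed.

Definition dotr := (dotDr, dotNr, dotZr, dot0r).

(** * Exposed faces of a vector configuration *)

Section Faces.
Variables (R : realType) (m : nat) (T : Type) (w : T -> 'rV[R]_m).
Hypothesis finT : finite_set [set: T].
Implicit Types (c y : 'cV[R]_m) (F : set T).

(** Only the indices of the vectors on a face matter, so a face is this set F
    of indices; c is an inner normal. That the empty set is exposed means that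
    c is positive on all the vectors, and so that the cone they span is
    pointed. *)
Definition exposes c F :=
  forall k, (F k -> dot (w k) c = 0) /\ (~ F k -> 0 < dot (w k) c).

Lemma exposes_ge0 c F k : exposes c F -> 0 <= dot (w k) c.
Proof.
move=> cF; have [Fk|Fk] := pselect (F k); first by rewrite (cF k).1.
exact/ltW/(cF k).2.
Qed.

Lemma exposes_eq0 c F k : exposes c F -> dot (w k) c = 0 -> F k.
Proof. by move=> cF ck0; apply: contrapT => /(cF k).2; rewrite ck0 ltxx. Qed.

Lemma exposesT : exposes 0 setT.
Proof. by move=> k; split=> [_|[]//]; rewrite dot0r. Qed.

Lemma exposes_zeros c : (forall k, 0 <= dot (w k) c) ->
  exposes c [set k | dot (w k) c = 0].
Proof.
by move=> c_ge0 k; split=> //= /eqP ck; rewrite lt_neqAle eq_sym ck c_ge0.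
Qed.

(** A large multiple of c dominates y off F, where c is bounded away from 0
    because there are finitely many vectors; on F only y counts. In particular
    a face of a face is a face. *)
Lemma exposes_perturb c F y : exposes c F ->
  (forall k, F k -> 0 <= dot (w k) y) ->
  exists M, exposes (M *: c + y) (F `&` [set k | dot (w k) y = 0]).
Proof.
move=> cF yF.
have [M [M0 Mb]] := finite_bound (fun k => `|dot (w k) y| / dot (w k) c) finT.
exists M => k; rewrite !dotr /=; split.
  by move=> [Fk ->]; rewrite (cF k).1// mulr0 addr0.
move=> nFk; have [Fk|/(cF k).2 ck] := pselect (F k).
  rewrite (cF k).1// mulr0 add0r lt_neqAle yF// andbT eq_sym.
  by apply/eqP => y0; apply: nFk.
have := Mb k; rewrite ltr_pdivrMr// => lt_y.
by have := ler_norm (- dot (w k) y); rewrite normrN; lra.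
Qed.

Hypothesis vert : forall v, exists c, exposes c [set v].

(** The ratio test of the simplex algorithm: t is the least value of y / z on
    F away from v, so y - t z is nonnegative on F and exposes a face of F that
    contains v and the minimizer k0. *)
Lemma face_cut z v c F y l :
  exposes z [set v] -> exposes c F -> F v -> dot (w v) y = 0 ->
  F l -> l <> v ->
  exists k0 t c', [/\ F k0 /\ k0 <> v, dot (w k0) y = t * dot (w k0) z,
    forall k, F k -> t * dot (w k) z <= dot (w k) y &
    exposes c' (F `&` [set k | dot (w k) y = t * dot (w k) z])].
Proof.
move=> zv cF Fv yv Fl lv.
have [k0 [[Fk0 k0v] min_k0]] := @finite_argmin R T (fun k => F k /\ k <> v)
  (fun k => dot (w k) y / dot (w k) z) l finT (conj Fl lv).
set t := _ / _ in min_k0.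
have le_t k : F k -> t * dot (w k) z <= dot (w k) y.
  move=> Fk; have [->|kv] := pselect (k = v).
    by rewrite yv (zv v).1// mulr0.
  by rewrite -ler_pdivlMr ?(zv k).2//; apply: min_k0.
have [|M cM] := @exposes_perturb c F (y - t *: z) cF.
  by move=> k Fk; rewrite dotBr dotZr subr_ge0 le_t.
exists k0, t, (M *: c + (y - t *: z)); split=> //.
  by rewrite mulfVK// gt_eqF// (zv k0).2.
suff -> : [set k | dot (w k) y = t * dot (w k) z] =
          [set k | dot (w k) (y - t *: z) = 0] by [].
by apply/seteqP; split=> k /=; rewrite dotBr dotZr;
  [move=> ->; rewrite subrr | move/subr0_eq].
Qed.

(** A minimal face among those that strictly contain v is an edge. If it held
    two more vertices k and j, a combination y of functionals exposing k and j
    could be chosen to vanish at v; it has opposite signs at k and j, so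
    [face_cut] yields a face that still strictly contains v and misses j. *)
Lemma face_edge v c F l : exposes c F -> F v -> F l -> l <> v ->
  exists u c', [/\ F u, u <> v & exposes c' [set v; u]].
Proof.
move=> cF Fv Fl lv; have [z zv] := vert v.
have [|F' [subF [[c' cF'] F'v [k [F'k kv]]] minF]] := @finite_minimal_set T
  (fun F => [/\ exists c, exposes c F, F v & exists k, F k /\ k <> v]) F finT.
  by split=> //; [exists c | exists l].
exists k, c'; split=> //; first exact: subF.
suff -> : [set v; k] = F' by [].
apply/seteqP; split=> [_ [->|->]//|j F'j] /=.
apply: contrapT => /not_orP[jv jk].
have [qk qkP] := vert k; have [qj qjP] := vert j.
pose y := dot (w v) qj *: qk - dot (w v) qk *: qj.
have vk_gt0 : 0 < dot (w v) qk by apply: (qkP v).2 => vk; apply: kv.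
have vj_gt0 : 0 < dot (w v) qj by apply: (qjP v).2 => vj; apply: jv.
have yv : dot (w v) y = 0 by rewrite dotBr !dotr mulrC subrr.
have [k0 [t [c'' [[F'k0 k0v] yk0 le_t c''F]]]] := face_cut zv cF' F'v yv F'k kv.
have t_lt0 : t < 0.
  have := le_t k F'k; have := (zv k).2 kv.
  have kj : 0 < dot (w k) qj by apply: (qjP k).2 => kj; apply: jk.
  rewrite dotBr !dotr (qkP k).1// mulr0 add0r => zk le_tk.
  by rewrite -(pmulr_llt0 _ zk) (le_lt_trans le_tk)// oppr_lt0 mulr_gt0.
have F'E : F' `&` [set k | dot (w k) y = t * dot (w k) z] = F'.
  apply: minF; first exact: subIsetl.
  by split; [exists c'' | split=> //=; rewrite yv (zv v).1 ?mulr0 | exists k0].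
move: F'j; rewrite -F'E => -[_ /=]; rewrite dotBr !dotr (qjP j).1// mulr0 subr0.
have : 0 < dot (w v) qj * dot (w j) qk by rewrite mulr_gt0// (qkP j).2.
by move=> lhs eq; move: lhs; rewrite eq ltNge pmulr_lle0 ?ltW// (zv j).2.
Qed.

(** If y were negative somewhere on F, [face_cut] would give a face of F,
    strictly containing v, on which y is a negative multiple of z; by
    [face_edge] it contains a neighbor of v, where y is negative. *)
Lemma local_global c F v y : exposes c F -> F v -> dot (w v) y = 0 ->
  (forall u c', F u -> u <> v -> exposes c' [set v; u] -> 0 <= dot (w u) y) ->
  forall k, F k -> 0 <= dot (w k) y.
Proof.
move=> cF Fv yv y_nb k Fk; rewrite leNgt; apply/negP => yk.
have kv : k <> v by move=> kv; move: yk; rewrite kv yv ltxx.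
have [z zv] := vert v.
have [k0 [t [c' [[Fk0 k0v] yk0 le_t c'F]]]] := face_cut zv cF Fv yv Fk kv.
have t_lt0 : t < 0.
  by rewrite -(pmulr_llt0 _ ((zv k).2 kv)) (le_lt_trans (le_t k Fk)).
have [||u [c'' [[Fu /= yu] uv edge]]] := face_edge c'F _ _ k0v; [|by []|].
  by split=> //=; rewrite yv (zv v).1// mulr0.
have := y_nb u c'' Fu uv edge; rewrite leNgt yu => /negP; apply.
by rewrite pmulr_llt0// (zv u).2.
Qed.

End Faces.

Section ExposedPoints.
Variables (R : realType) (m : nat) (T : Type) (w : T -> 'rV[R]_m).
Hypothesis finT : finite_set [set: T].

(** One of three collinear points lies between the two others, and a functional
    cannot vanish there while it is positive at both of them. *)
Lemma exposed_collinear i j k t : (forall k, exists c, exposes w c [set k]) ->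
  w k = w i + t *: (w j - w i) -> [set i; j] k.
Proof.
move=> vert wk; apply: contrapT => /not_orP[ki kj].
have wkE c : dot (w k) c = dot (w i) c + t * (dot (w j) c - dot (w i) c).
  by rewrite wk dotDl dotZl dotBl.
have [ij|ij] := pselect (i = j).
  have [q qP] := vert k; have := wkE q; rewrite -ij subrr mulr0 addr0 (qP k).1// => qi.
  by have := (qP i).2 (fun E => ki (esym E)); rewrite -qi ltxx.
have [t_lt0|t_ge0] := ltP t 0.
  have [q qP] := vert i; have := wkE q; rewrite (qP i).1// add0r subr0.
  have := (qP k).2 ki; have := (qP j).2 (fun E => ij (esym E)) => qj qk qE.
  by move: qk; rewrite qE ltNge nmulr_rle0 ?ltW.
have [t_gt1|t_le1] := ltP 1 t.
  have [q qP] := vert j; have := wkE q; rewrite (qP j).1// sub0r.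
  have := (qP k).2 kj; have := (qP i).2 ij => qi qk qE.
  have : 0 < (t - 1) * dot (w i) q by rewrite mulr_gt0// subr_gt0.
  by move: qk; rewrite qE; lra.
have [q qP] := vert k; have := wkE q; rewrite (qP k).1//.
have := (qP i).2 (fun E => ki (esym E)); have := (qP j).2 (fun E => kj (esym E)).
move=> qj qi qE.
have : 0 <= t * dot (w j) q by rewrite mulr_ge0// ltW.
have : 0 <= (1 - t) * dot (w i) q by rewrite mulr_ge0// ?subr_ge0// ltW.
have [t0|t0] := eqVneq t 0; first by move: qE; rewrite t0; lra.
have : 0 < t * dot (w j) q by rewrite mulr_gt0// lt_neqAle eq_sym t0.
by move: qE; lra.
Qed.

(** Among the faces on which y is minimal take a smallest one. If it contained
    two different vectors, a coordinate taking different values on them would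
    cut out a smaller face. The functional p lets constants be subtracted. *)
Lemma exposed_min p y (l : T) : (forall k, dot (w k) p = 1) ->
  exists k c, exposes w c [set j | w j = w k] /\
    forall j, dot (w k) y <= dot (w j) y.
Proof.
move=> p1.
have cut c F x k : exposes w c F -> F k ->
    (forall j, F j -> dot (w k) x <= dot (w j) x) ->
    exists c', exposes w c' (F `&` [set j | dot (w j) x = dot (w k) x]).
  move=> cF Fk min_k.
  have [|M cM] := exposes_perturb finT cF (y := x - dot (w k) x *: p).
    by move=> j Fj; rewrite dotBr dotZr p1 mulr1 subr_ge0 min_k.
  exists (M *: c + (x - dot (w k) x *: p)).
  suff -> : [set j | dot (w j) x = dot (w k) x] =
            [set j | dot (w j) (x - dot (w k) x *: p) = 0] by [].
  by apply/seteqP; split=> j /=; rewrite dotBr dotZr p1 mulr1;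
    [move=> ->; rewrite subrr | move/subr0_eq].
have [k0 [_ min_k0]] :=
  finite_argmin (P := setT) (fun k => dot (w k) y) finT (x := l) I.
have [c0 c0F] := cut 0 setT y k0 (exposesT w) I min_k0.
have [|F' [subF [[c cF] [k Fk]] minF]] := @finite_minimal_set T
  (fun F => (exists c, exposes w c F) /\ exists k, F k)
  (setT `&` [set j | dot (w j) y = dot (w k0) y]) finT.
  by split; [exists c0; exact: c0F | exists k0].
exists k, c; split; last first.
  by move=> j; have [_ /= ->] := subF k Fk; apply: min_k0.
suff -> : [set j | w j = w k] = F' by [].
apply/seteqP; split=> j /=.
  by move=> wj; apply: (exposes_eq0 cF); rewrite wj (cF k).1.
move=> Fj; apply/rowP => i.
have dot_coord (x : 'rV[R]_m) : x 0 i = dot x (delta_mx i 0 : 'cV[R]_m).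
  rewrite /dot mxE (bigD1 i)//= mxE !eqxx mulr1 big1 ?addr0// => i' /negPf i'i.
  by rewrite mxE i'i mulr0.
have [k1 [Fk1 min_k1]] :=
  finite_argmin (P := F') (fun k => dot (w k) (delta_mx i 0)) finT Fk.
have [c1 c1F] := cut c F' _ k1 cF Fk1 min_k1.
have E : F' `&` [set j | dot (w j) (delta_mx i 0) = dot (w k1) (delta_mx i 0)] = F'.
  by apply: minF; [exact: subIsetl | split; [exists c1 | exists k1]].
move: Fj Fk; rewrite -E !dot_coord => -[_ /= ->] [_ /= ->].
by [].
Qed.

End ExposedPoints.

(** * Realizations of a graph by vectors *)

(** n vectors that separate the points of the dual of R^n form a basis. *)
Lemma separating_basis (R : realType) n (p : 'I_n -> 'rV[R]_n) :
  (forall c, (forall i, dot (p i) c = 0) -> c = 0) ->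
  forall b : 'I_n -> R, exists c, forall i, dot (p i) c = b i.
Proof.
move=> sep b; pose M : 'M[R]_n := \matrix_(i < n) p i.
have dotM c i : dot (p i) c = (M *m c) i 0.
  by rewrite -[p i](rowK p) /dot -row_mul mxE.
have uM : M \in unitmx.
  rewrite -unitmx_tr -row_free_unit -kermx_eq0; apply/rowV0P => x /sub_kermxP xM.
  apply: trmx_inj; rewrite trmx0; apply: sep => i; rewrite dotM.
  by rewrite -[M]trmxK -trmx_mul xM trmx0 mxE.
exists (invmx M *m \col_(i < n) b i) => i.
by rewrite dotM mulmxA mulmxV// mul1mx mxE.
Qed.

Section Realization.
Variables (R : realType) (d : nat).

(** The vectors are the vertices of a polytope in homogeneous coordinates, up
    to positive factors. Separating functionals means spanning R^(d+1), so it
    says that the polytope has dimension d; the functional that is positive on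
    all the vectors defines an affine chart containing them. *)
Record realizes (G : sgraph) (w : G -> 'rV[R]_d.+1) : Prop := Realizes {
  realizes_finite : finite_set [set: G];
  realizes_separating : forall c, (forall k, dot (w k) c = 0) -> c = 0;
  realizes_positive : exists c, exposes w c set0;
  realizes_vertex : forall v, exists c, exposes w c [set v];
  realizes_edge : forall u v, u <> v ->
    (adj u v <-> exists c, exposes w c [set u; v]) }.

Lemma realizes_isograph (G H : sgraph) (f : G -> H) (w : H -> 'rV[R]_d.+1) :
  bijective f -> (forall x y, adj x y <-> adj (f x) (f y)) ->
  realizes w -> realizes (w \o f).
Proof.
move=> [g fK gK] fadj [fin sep [p pP] vert edge].
have pull c F F' : (forall x, F' x <-> F (f x)) -> exposes w c F ->
    exposes (w \o f) c F'.
  by move=> FF cF k; have [c0 cp] := cF (f k); split=> [/FF//|nF]; apply: cp => /FF.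
have push c F F' : (forall x, F' x <-> F (f x)) -> exposes (w \o f) c F' ->
    exposes w c F.
  move=> FF cF k; have := cF (g k); rewrite /= gK => -[c0 cp].
  by split=> [Fk|nF]; [apply: c0; apply/FF | apply: cp => /FF]; rewrite gK.
have inj_f x y : f x = f y -> x = y by apply: can_inj.
split.
- have := finite_image g fin; apply: sub_finite_set => x _.
  by exists (f x).
- move=> c cf; apply: sep => k; have := cf (g k); by rewrite /= gK.
- by exists p; apply: pull pP.
- move=> v; have [c cP] := vert (f v); exists c; apply: pull cP => x /=.
  by split=> [->|/inj_f].
move=> u v uv; rewrite fadj edge; last by move/inj_f.
have E x : [set u; v] x <-> [set f u; f v] (f x).
  by split=> [[->|->]|[]/inj_f ->]; [left|right|left|right].
by split=> -[c cP]; exists c; [apply: pull cP | apply: push cP].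
Qed.

Variables (G : sgraph) (w : G -> 'rV[R]_d.+1) (w_real : realizes w).
Implicit Types (u v k : G) (c y : 'cV[R]_d.+1) (F : set G).

Lemma face_neighbor v c F l : exposes w c F -> F v -> F l -> l <> v ->
  exists u, F u /\ adj v u.
Proof.
move=> cF Fv Fl lv.
have [u [c' [Fu uv edge]]] :=
  face_edge (realizes_finite w_real) (realizes_vertex w_real) cF Fv Fl lv.
exists u; split=> //; apply/(realizes_edge w_real); first by move=> vu; apply: uv.
by exists c'.
Qed.

Lemma face_ge0 v c F y : exposes w c F -> F v -> dot (w v) y = 0 ->
  (forall u, F u -> adj v u -> 0 <= dot (w u) y) ->
  forall k, F k -> 0 <= dot (w k) y.
Proof.
move=> cF Fv yv y_nb; apply: (local_global (realizes_finite w_real)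
  (realizes_vertex w_real) cF Fv yv) => u c' Fu uv edge.
apply: y_nb => //; apply/(realizes_edge w_real); first by move=> vu; apply: uv.
by exists c'.
Qed.

Lemma face_eq0 v c F y : exposes w c F -> F v -> dot (w v) y = 0 ->
  (forall u, F u -> adj v u -> dot (w u) y = 0) ->
  forall k, F k -> dot (w k) y = 0.
Proof.
move=> cF Fv yv y_nb k Fk; apply/eqP; rewrite eq_le -oppr_ge0 -dotNr.
apply/andP; split.
  apply: (face_ge0 cF Fv) => //; first by rewrite dotNr yv oppr0.
  by move=> u Fu uv; rewrite dotNr (y_nb u)// oppr0.
by apply: (face_ge0 cF Fv) => // u Fu uv; rewrite (y_nb u).
Qed.

Lemma cone_ge0 v y : dot (w v) y = 0 ->
  (forall u, adj v u -> 0 <= dot (w u) y) -> forall k, 0 <= dot (w k) y.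
Proof.
by move=> yv y_nb k; apply: (face_ge0 (exposesT w) _ yv) => // u _; apply: y_nb.
Qed.

Lemma cone_eq0 v y : dot (w v) y = 0 ->
  (forall u, adj v u -> dot (w u) y = 0) -> forall k, dot (w k) y = 0.
Proof.
by move=> yv y_nb k; apply: (face_eq0 (exposesT w) _ yv) => // u _; apply: y_nb.
Qed.

(** By [cone_eq0], v and its at most d neighbors separate functionals, so that
    these d + 1 vectors are a basis. The function nb bounds the number of
    neighbors by d. *)
Lemma simple_values v (nb : 'I_d -> G) (b : G -> R) :
  (forall u, adj v u -> exists i, nb i = u) ->
  exists c, dot (w v) c = b v /\ forall u, adj v u -> dot (w u) c = b u.
Proof.
move=> nb_surj.
pose p i := if unlift ord0 i is Some j then nb j else v.
have [c cP|c cb] := @separating_basis R d.+1 (w \o p) _ (b \o p).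
  apply: (realizes_separating w_real); apply: (@cone_eq0 v).
    by have := cP ord0; rewrite /= /p unlift_none.
  move=> u /nb_surj[i <-]; have := cP (lift ord0 i).
  by rewrite /= /p liftK.
exists c; split=> [|u /nb_surj[i <-]].
  by have := cb ord0; rewrite /= /p unlift_none.
by have := cb (lift ord0 i); rewrite /= /p liftK.
Qed.

(** A functional exposing v, slightly tilted by a positive one. *)
Lemma truncating_hyperplane v :
  exists h, dot (w v) h < 0 /\ forall k, k <> v -> 0 < dot (w k) h.
Proof.
have [z zv] := realizes_vertex w_real v; have [p pP] := realizes_positive w_real.
have [M [M0 ltM]] :=
  finite_bound (fun k => dot (w k) p / dot (w k) z) (realizes_finite w_real).
exists (M *: z - p); rewrite !dotr (zv v).1// mulr0 add0r oppr_lt0.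
split=> [|k kv]; first by apply: (pP v).2; apply.
by rewrite !dotr subr_gt0 -ltr_pdivrMr// (zv k).2.
Qed.

End Realization.

(** * The vertices of a star-clique *)

Section StarCliqueVertices.
Variables (G : sgraph) (v : G).

Lemma old_neq (a : set_type [set~ v]) : val a <> v.
Proof. exact: set_mem (valP a). Qed.

Lemma vertex_cases (P : G -> Prop) :
  P v -> (forall a : set_type [set~ v], P (val a)) -> forall k, P k.
Proof.
move=> Pv Pa k; have [->//|kv] := pselect (k = v).
exact: (Pa (@elem _ [set~ v] _ kv)).
Qed.

Lemma clique_adj (u : set_type (neighbors v)) : adj v (val u).
Proof. exact: set_mem (valP u). Qed.

Lemma clique_neq (u : set_type (neighbors v)) : val u <> v.
Proof. by move=> uv; have := clique_adj u; rewrite uv; apply: adj_irrefl. Qed.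

Arguments old_neq a _ : clear implicits.
Arguments clique_neq u _ : clear implicits.

Definition old k (kv : k <> v) : star_clique v :=
  inl (@elem _ [set~ v] _ kv).

(** The only neighbor outside the clique of the clique vertex labelled u. *)
Definition foot (u : set_type (neighbors v)) : star_clique v :=
  old (clique_neq u).

Lemma foot_inj : injective foot.
Proof. by move=> u u' [] /val_inj. Qed.

Lemma foot_adj u : adj (inr u : star_clique v) (foot u).
Proof. by []. Qed.

Lemma adj_clique (u : set_type (neighbors v)) (x : star_clique v) :
  adj (inr u : star_clique v) x ->
  (exists2 u', u' <> u & x = inr u') \/ x = foot u.
Proof.
case: x => [a|u'] /= au; last by left; exists u' => // ?; apply: au.
by right; congr inl; apply: val_inj.
Qed.

Lemma degree_enum d : has_degree v d ->
  exists nb : 'I_d -> set_type (neighbors v), bijective nb.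
Proof.
move=> /card_enum[g [gA ginj gsurj]].
pose nb i : set_type (neighbors v) := @elem _ (neighbors v) _ (gA i).
have /choice[inv invP] (u : set_type (neighbors v)) : exists i, nb i = u.
  by have [i gi] := gsurj _ (clique_adj u); exists i; apply: val_inj.
by exists nb, inv => // i; apply: ginj; have /(congr1 val) := invP (nb i).
Qed.

End StarCliqueVertices.

Arguments old_neq {G v} a _.
Arguments clique_neq {G v} u _.

(** * Truncating a simple vertex *)

Section Truncation.
Variables (R : realType) (d : nat) (d_gt0 : (0 < d)%N) (G : sgraph) (v : G).
Variables (hv : has_degree v d) (w : G -> 'rV[R]_d.+1) (w_real : realizes w).
Variables (h : 'cV[R]_d.+1) (hv_lt0 : dot (w v) h < 0).
Hypothesis h_gt0 : forall k, k <> v -> 0 < dot (w k) h.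
Implicit Types (y c : 'cV[R]_d.+1) (u : set_type (neighbors v)).

(** The vertex labelled u goes to the point where h vanishes on the edge from
    v to u. *)
Definition truncation (x : star_clique v) : 'rV[R]_d.+1 :=
  match x with
  | inl a => w (val a)
  | inr u => dot (w (val u)) h *: w v - dot (w v) h *: w (val u)
  end.

Lemma truncation_inr u y : dot (truncation (inr u)) y =
  dot (w (val u)) h * dot (w v) y - dot (w v) h * dot (w (val u)) y.
Proof. by rewrite /= dotBl !dotZl. Qed.

Lemma truncation_inr_gt0 u y : 0 < dot (w v) y -> 0 <= dot (w (val u)) y ->
  0 < dot (truncation (inr u)) y.
Proof.
move=> yv yu; rewrite truncation_inr ltr_pwDl ?mulr_gt0 ?h_gt0//.
  exact: clique_neq.
by rewrite -mulNr mulr_ge0// oppr_ge0 ltW.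
Qed.

(** The functional y - (y(v) / h(v)) h vanishes at v. At a neighbor u of v its
    sign is that of y at the new vertex labelled u, since h vanishes there; so
    [cone_ge0] applies. *)
Lemma truncation_ge y : (forall u, 0 <= dot (truncation (inr u)) y) ->
  forall k, dot (w v) y / dot (w v) h * dot (w k) h <= dot (w k) y.
Proof.
move=> yK k; rewrite -subr_ge0 -dotZr -dotBr.
apply: (cone_ge0 w_real (v := v)) => [|u vu].
  by rewrite !dotr mulfVK ?subrr// lt_eqF.
rewrite !dotr; have := yK (@elem _ (neighbors v) _ vu).
rewrite truncation_inr /= => yu.
rewrite -(nmulr_lle0 _ hv_lt0) mulrBl mulrAC mulfVK ?lt_eqF//.
by move: yu; lra.
Qed.

Lemma truncation_gt0 y : dot (w v) y < 0 ->
  (forall u, 0 <= dot (truncation (inr u)) y) ->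
  forall k, k <> v -> 0 < dot (w k) y.
Proof.
move=> yv yK k kv; apply: lt_le_trans (truncation_ge yK k).
by rewrite mulr_gt0 ?h_gt0// nmulr_rgt0// invr_lt0.
Qed.

Lemma degree_surj : exists nb : 'I_d -> G, forall k, adj v k -> exists i, nb i = k.
Proof.
have [nb [inv _ invK]] := degree_enum hv; exists (val \o nb) => u vu.
pose u' : set_type (neighbors v) := @elem _ (neighbors v) _ vu.
by exists (inv u'); rewrite /= invK.
Qed.

(** Since h exposes the whole clique, it suffices to add a functional that
    vanishes at v and on S and equals 1 at the neighbors of v outside S; by
    [cone_ge0] it is nonnegative. *)
Lemma truncation_clique_face (S : set (set_type (neighbors v))) :
  exists c, exposes truncation c [set x | if x is inr u then S u else False].
Proof.
have [nb nb_surj] := degree_surj.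
pose b k : R := `[< k <> v /\ forall u, val u = k -> ~ S u >]%:R.
have [y [yv yu]] := simple_values w_real b nb_surj.
have y0 : dot (w v) y = 0 by rewrite yv /b; case: asboolP => // -[].
have y_ge0 : forall k, 0 <= dot (w k) y.
  by apply: (cone_ge0 w_real y0) => u /yu ->.
exists (h + y) => -[a|u]; split=> //=.
- by move=> _; rewrite dotDr ltr_pwDl// h_gt0//; apply: old_neq.
- move=> Su; rewrite dotBl !dotZl !dotDr y0 yu; last exact: clique_adj.
  by rewrite /b; case: asboolP => [[_ /(_ u erefl)]//|_]; rewrite !addr0 mulrC subrr.
- move=> nSu; rewrite dotBl !dotZl !dotDr y0 yu; last exact: clique_adj.
  rewrite /b; case: asboolP => [_|[]].
    by move: hv_lt0 => /=; lra.
  by split; [exact: clique_neq | move=> u' /val_inj ->].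
Qed.

(** If c exposes {a, b} after the truncation then c(v) > 0, so c exposes {a, b}
    before it. Indeed c(v) < 0 contradicts [truncation_gt0], and if c(v) = 0
    then the face of c through v and a contains a neighbor u of v, and c
    vanishes at the new vertex on the edge from v to u, which is neither a
    nor b. *)
Lemma truncation_adj_ll a b : a <> b ->
  (adj (val a) (val b) <-> exists c,
     exposes truncation c [set (inl a : star_clique v); inl b]).
Proof.
move=> ab; rewrite (realizes_edge w_real); last by move/val_inj.
have lP (x : set_type [set~ v]) : [set val a; val b] (val x) <->
    [set (inl a : star_clique v); inl b] (inl x).
  by split=> [[/val_inj->|/val_inj->]|[[->]|[->]]]; [left|right|left|right].
split=> -[c cP]; exists c.
  move=> [x|u]; first by rewrite -lP; exact: cP.
  split=> [[]//|_]; apply: truncation_inr_gt0; last exact: exposes_ge0 cP.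
  by apply: (cP v).2 => -[/esym/old_neq|/esym/old_neq].
have cK u : 0 < dot (truncation (inr u)) c by apply: (cP (inr u)).2 => -[].
have c_old k (kv : k <> v) := cP (old kv).
have ca0 : dot (w (val a)) c = 0 by apply: (cP (inl a)).1; left.
have cv : 0 < dot (w v) c.
  rewrite lt_neqAle eq_sym leNgt; apply/andP; split; last first.
    apply/negP => /truncation_gt0/(_ (fun u => ltW (cK u)) _ (old_neq a)).
    by rewrite ca0 ltxx.
  apply/eqP => cv.
  have c_ge0 k : 0 <= dot (w k) c.
    have [->|kv] := pselect (k = v); first by rewrite cv.
    exact: (exposes_ge0 (old kv) cP).
  have [u [cu vu]] := face_neighbor w_real (exposes_zeros c_ge0) cv ca0 (old_neq a).
  have := cK (@elem _ (neighbors v) _ vu).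
  by rewrite truncation_inr /= cv cu !mulr0 subr0 ltxx.
move=> k; have [->|kv] := pselect (k = v).
  by split=> // -[/esym/old_neq|/esym/old_neq].
by have := c_old k kv; rewrite -lP.
Qed.

(** If c exposes {a, inr u} and a is not u, then c(u) > 0. As c vanishes at
    the new vertex, which lies on the edge from v to u, it is negative at v,
    hence positive at a by [truncation_gt0]. *)
Lemma truncation_adj_lr a u :
  val a = val u <-> exists c, exposes truncation c [set (inl a : star_clique v); inr u].
Proof.
split=> [au|[c cP]]; last first.
  apply: contrapT => au.
  have cu : 0 < dot (w (val u)) c.
    have := (cP (foot u)).2; apply=> -[[ua]|//]; by case: au; rewrite -ua.
  have ca : dot (w (val a)) c = 0 by apply: (cP (inl a)).1; left.
  have c0 : dot (truncation (inr u)) c = 0 by apply: (cP (inr u)).1; right.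
  suff cv : dot (w v) c < 0.
    have := truncation_gt0 cv (fun u' => exposes_ge0 (inr u') cP) (old_neq a).
    by rewrite ca ltxx.
  have hu := h_gt0 (clique_neq u).
  rewrite -(pmulr_rlt0 _ hu); move: c0; rewrite truncation_inr => /subr0_eq ->.
  by rewrite nmulr_rlt0.
have vu : v <> val u by move/esym; apply: clique_neq.
have [/(_ (clique_adj u))[c cP] _] := realizes_edge w_real vu.
exists c => -[b|u'].
  split=> [[[->]|//]|nb]; first by rewrite /= au; apply: (cP _).1; right.
  apply: (cP (val b)).2 => -[/old_neq//|]; rewrite -au => /val_inj ba.
  by apply: nb; left; rewrite ba.
have cv : dot (w v) c = 0 by apply: (cP v).1; left.
rewrite truncation_inr cv mulr0 add0r -mulNr; split=> [[//|[->]]|nu].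
  by rewrite (cP (val u)).1 ?mulr0//; right.
rewrite mulr_gt0 ?oppr_gt0//; apply: (cP (val u')).2.
by move=> [/clique_neq//|/val_inj uu]; apply: nu; right; rewrite uu.
Qed.

Lemma truncation_realizes : realizes truncation.
Proof.
have [nb nb_surj] := degree_surj.
split.
- have fin := finite_setX (realizes_finite w_real) (@finite_finset bool setT).
  pose f (x : star_clique v) : G * bool :=
    match x with inl a => (val a, true) | inr u => (val u, false) end.
  have f_inj : injective f by move=> [a|u] [b|u'] //= [] /val_inj ->.
  apply: (@card_le_finite _ _ _ ([set: G] `*` [set: bool])) => //.
  rewrite -(card_le_eql (inj_card_eq (f := f) (A := setT) _)).
    by apply: subset_card_le.
  by move=> x y _ _; apply: f_inj.
- move=> c c0.
  have c_old k : k <> v -> dot (w k) c = 0 by move=> kv; exact: (c0 (old kv)).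
  apply: (realizes_separating w_real) => k.
  have [->|/c_old//] := pselect (k = v).
  have [g _] := degree_enum hv; pose u := g (Ordinal d_gt0).
  have hu := h_gt0 (clique_neq u).
  have := c0 (inr u); rewrite truncation_inr (c_old _ (clique_neq u)).
  by rewrite mulr0 subr0 => /eqP; rewrite mulf_eq0 gt_eqF//= => /eqP.
- have [p pP] := realizes_positive w_real; exists p.
  have p_gt0 k : 0 < dot (w k) p by apply: (pP k).2.
  move=> [a|u]; split=> // _; first exact: p_gt0.
  by apply: truncation_inr_gt0 => //; exact: ltW.
- move=> [a|u].
    have [c cP] := realizes_vertex w_real (val a); exists c => -[b|u].
      split=> [[->]|ba]; first exact: (cP _).1.
      by apply: (cP (val b)).2 => /val_inj ab; apply: ba; rewrite ab.
    split=> // _; apply: truncation_inr_gt0; last exact: exposes_ge0 cP.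
    by apply: (cP v).2 => /esym/old_neq.
  have [c cP] := truncation_clique_face [set u]; exists c => x.
  suff -> : [set (inr u : star_clique v)] x = (if x is inr u' then u' = u else False).
    exact: cP.
  by apply/propext; case: x => [a|u'] /=; split=> // [[]|->].
move=> [a|u] [b|u'] ne.
- by apply: truncation_adj_ll => ab; apply: ne; rewrite ab.
- exact: truncation_adj_lr.
- by rewrite /= setUC; exact: truncation_adj_lr.
split=> [_|_ /= uu]; last by apply: ne; rewrite uu.
have [c cP] := truncation_clique_face [set u; u']; exists c => x.
suff -> : [set (inr u : star_clique v); inr u'] x =
  (if x is inr u0 then [set u; u'] u0 else False) by apply: cP.
apply/propext; case: x => [a|u0] /=; first by split=> // -[].
by split=> [[[->]|[->]]|[->|->]]; [left|right|left|right].
Qed.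

End Truncation.

(** * Undoing a truncation *)

Section Untruncation.
Variables (R : realType) (d : nat) (d_gt1 : (1 < d)%N) (G : sgraph) (v : G).
Variables (hv : has_degree v d) (w : star_clique v -> 'rV[R]_d.+1).
Hypothesis w_real : realizes w.
Implicit Types (y c : 'cV[R]_d.+1) (u : set_type (neighbors v)).

Let clique : set (star_clique v) := [set x | if x is inr _ then True else False].

(** [face_ge0] at a vertex of the clique, whose neighbors are the rest of the
    clique and one foot. *)
Lemma clique_face_ge0 u c F y : exposes w c F -> F (inr u) ->
  dot (w (inr u)) y = 0 -> (forall u', F (inr u') -> 0 <= dot (w (inr u')) y) ->
  (F (foot u) -> 0 <= dot (w (foot u)) y) -> forall k, F k -> 0 <= dot (w k) y.
Proof.
move=> cF Fu yu yK y_foot; apply: (face_ge0 w_real cF Fu yu) => x Fx.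
by move=> /adj_clique[[u' _ xE]|xE]; move: Fx; rewrite xE; [exact: yK|exact: y_foot].
Qed.

Lemma clique_face_eq0 u c F y : exposes w c F -> F (inr u) ->
  (forall u', F (inr u') -> dot (w (inr u')) y = 0) ->
  (F (foot u) -> dot (w (foot u)) y = 0) -> forall k, F k -> dot (w k) y = 0.
Proof.
move=> cF Fu yK y_foot; apply: (face_eq0 w_real cF Fu (yK u Fu)) => x Fx.
by move=> /adj_clique[[u' _ xE]|xE]; move: Fx; rewrite xE; [exact: yK|exact: y_foot].
Qed.

Lemma clique_values u (b : star_clique v -> R) :
  exists c, (forall u', dot (w (inr u')) c = b (inr u')) /\
            dot (w (foot u)) c = b (foot u).
Proof.
have [nb [inv _ nbK]] := degree_enum hv.
pose nb' i : star_clique v := if pselect (nb i = u) then foot u else inr (nb i).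
have [x|c [cu cN]] := simple_values w_real b (v := inr u) (nb := nb').
  move=> /adj_clique[[u' u'u ->]|->]; [exists (inv u') | exists (inv u)];
    by rewrite /nb' nbK; case: pselect.
exists c; split=> [u'|]; last by apply: cN; apply: foot_adj.
have [->//|u'u] := pselect (u' = u).
by apply: cN => /= uu; apply: u'u.
Qed.

Lemma clique_nonempty : exists u : set_type (neighbors v), True.
Proof.
by have [nb _] := degree_enum hv; exists (nb (Ordinal (ltnW d_gt1))).
Qed.

Lemma clique_other (P : set_type (neighbors v) -> Prop) :
  (forall u u', P u -> P u' -> u = u') -> exists u, ~ P u.
Proof.
move=> P1; have [nb [inv nbK _]] := degree_enum hv.
have [/P1 Pu|] := pselect (P (nb (Ordinal (ltnW d_gt1)))); last by eexists; eauto.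
by exists (nb (Ordinal d_gt1)) => /Pu /(can_inj nbK).
Qed.

(** The functional h that vanishes on the clique and is 1 at the foot of u0 is
    nonnegative, and it is positive at every foot, as otherwise it would vanish
    at some clique vertex and at all its neighbors. To see that it is positive
    at any old vertex a, take q exposing a and p positive: on the face of h, the
    minimum of q / p over the clique is a local minimum, because the feet are
    not in this face. So it is a global one, whereas q / p vanishes at a. *)
Lemma clique_exposed : exists h, exposes w h clique.
Proof.
have [u0 _] := clique_nonempty.
have [h [hK h_foot]] := clique_values u0 (fun x => if x is inl _ then 1 else 0).
have h_ge0 : forall x, 0 <= dot (w x) h.
  move=> x; apply: (clique_face_ge0 (exposesT w) (u := u0)) => //.
  - by move=> u _; rewrite hK.
  - by move=> _; rewrite h_foot.
have h_foot_gt0 u : 0 < dot (w (foot u)) h.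
  rewrite lt_neqAle h_ge0 andbT; apply/eqP => hu.
  have : dot (w (foot u0)) h = 0.
    by apply: (clique_face_eq0 (exposesT w) (u := u)) => // u' _; rewrite hK.
  by rewrite h_foot => /eqP; rewrite oner_eq0.
exists h => -[a|u]; [split=> //= _ | by split=> [_|[]//]; exact: hK].
rewrite lt_neqAle h_ge0 andbT; apply/eqP => /esym ha.
have [q qP] := realizes_vertex w_real (inl a).
have [p pP] := realizes_positive w_real.
have p_gt0 x : 0 < dot (w x) p by exact: (pP x).2.
have [[b|u] [// _ min_u]] := @finite_argmin R _ clique
  (fun x => dot (w x) q / dot (w x) p) (inr u0) (realizes_finite w_real) I.
set t := _ / _ in min_u.
have t_gt0 : 0 < t by rewrite divr_gt0 ?p_gt0//; apply: (qP _).2.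
suff : 0 <= dot (w (inl a)) (q - t *: p).
  rewrite dotBr dotZr (qP _).1// sub0r oppr_ge0 leNgt => /negP; apply.
  by rewrite mulr_gt0.
apply: (clique_face_ge0 (exposes_zeros h_ge0) (u := u)) => //=.
- by rewrite dotBr dotZr mulfVK ?subrr// gt_eqF.
- by move=> u' _; rewrite dotBr dotZr subr_ge0 -ler_pdivlMr// min_u.
- by move=> hu; have := h_foot_gt0 u; rewrite hu ltxx.
Qed.

Variables (h : 'cV[R]_d.+1) (h_clique : exposes w h clique).

Lemma clique_eq0 u : dot (w (inr u)) h = 0. Proof. exact: (h_clique _).1. Qed.

Lemma old_gt0 a : 0 < dot (w (inl a)) h. Proof. by apply: (h_clique _).2. Qed.

Definition facet_at u e := [/\ forall x, 0 <= dot (w x) e,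
  dot (w (inr u)) e = 1, forall u', u' <> u -> dot (w (inr u')) e = 0 &
  forall u', u' <> u -> dot (w (foot u')) e = 0].

(** Choose u1 other than u, and let e be 1 at u, 0 on the rest of the clique
    and 0 at the foot of u1; it is nonnegative by [cone_ge0] at u1. If the face of
    e missed the foot of some u' other than u, then all the neighbors of u' in
    this face would be in the clique; as h vanishes there, it would vanish on
    the whole face, which contains the foot of u1. *)
Lemma clique_facet u : exists e, facet_at u e.
Proof.
have [|u1 u1u] := clique_other (P := fun u' => u' = u) _; first by move=> ? ? -> ->.
have [e [eK e_foot]] :=
  clique_values u1 (fun x => if x is inr u' then `[< u' = u >]%:R else 0).
have eu : dot (w (inr u)) e = 1 by rewrite eK; case: asboolP.
have eu' u' : u' <> u -> dot (w (inr u')) e = 0 by rewrite eK; case: asboolP.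
have e_ge0 x : 0 <= dot (w x) e.
  apply: (clique_face_ge0 (exposesT w) (u := u1)) => //; first exact: eu'.
  - by move=> u' _; rewrite eK; case: asboolP.
  - by rewrite e_foot.
exists e; split=> // u' u'u; apply: contrapT => nFu'.
have : dot (w (foot u1)) h = 0.
  apply: (clique_face_eq0 (exposes_zeros e_ge0) (u := u')) => //=.
  - exact: eu'.
  - by move=> u2 _; apply: clique_eq0.
by apply/eqP; rewrite gt_eqF// old_gt0.
Qed.

Variables (e : set_type (neighbors v) -> 'cV[R]_d.+1).
Hypothesis eP : forall u, facet_at u (e u).
Variables (nb : 'I_d -> set_type (neighbors v)) (nb_bij : bijective nb).
Variable u0 : set_type (neighbors v).

Lemma facet_ge0 u x : 0 <= dot (w x) (e u).
Proof. by have [] := eP u. Qed.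

Lemma facet_self u : dot (w (inr u)) (e u) = 1.
Proof. by have [] := eP u. Qed.

Lemma facet_other u u' : u' <> u -> dot (w (inr u)) (e u') = 0.
Proof. by have [_ _ e0 _] := eP u'; move=> uu'; apply: e0 => /esym. Qed.

Lemma facet_foot u u' : u' <> u -> dot (w (foot u)) (e u') = 0.
Proof. by have [_ _ _ e0] := eP u'; move=> uu'; apply: e0 => /esym. Qed.

Let slope u := dot (w (foot u)) (e u).

(** The vector on which every e u vanishes and h is -1, as [apex_coords] shows.
    It is written as the point of the line through u0 and its foot where e u0
    vanishes, so that linearity in the functional is evident. *)
Definition apex : 'rV[R]_d.+1 :=
  (dot (w (foot u0)) h)^-1 *: (slope u0 *: w (inr u0) - w (foot u0)).

Lemma sum_facets (a : set_type (neighbors v) -> R) u x :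
  (forall u', u' <> u -> dot (w x) (e u') = 0) ->
  dot (w x) (\sum_i a (nb i) *: e (nb i)) = a u * dot (w x) (e u).
Proof.
have [inv nbK invK] := nb_bij => ex.
rewrite dot_sumr (bigD1 (inv u))//= invK dotZr big1 ?addr0// => i iu.
rewrite dotZr ex ?mulr0// => nbi; move: iu.
by rewrite -nbi nbK eqxx.
Qed.

(** The difference of the two sides vanishes on the clique and at the foot of
    u0, that is, at u0 and at all its neighbors. *)
Lemma apex_coords y x : dot (w x) y =
  \sum_i dot (w (inr (nb i))) y * dot (w x) (e (nb i)) - dot apex y * dot (w x) h.
Proof.
pose yK u := dot (w (inr u)) y; pose E := \sum_i yK (nb i) *: e (nb i).
have eqE : \sum_i dot (w (inr (nb i))) y * dot (w x) (e (nb i)) = dot (w x) E.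
  by rewrite dot_sumr; apply: eq_bigr => i _; rewrite dotZr.
rewrite eqE; apply/eqP; rewrite -subr_eq0 opprB addrA addrAC -dotZr -dotBr -dotDr.
apply/eqP; apply: (clique_face_eq0 (exposesT w) (u := u0)) => // [u _|_].
  rewrite dotDr dotBr dotZr clique_eq0 mulr0 addr0 (sum_facets yK (u := u))/yK.
    by rewrite facet_self mulr1 subrr.
  by move=> u'; exact: facet_other.
rewrite dotDr dotBr dotZr (sum_facets yK (u := u0))/yK; last first.
  by move=> u'; exact: facet_foot.
rewrite /apex dotZl dotBl dotZl mulrAC mulVf ?gt_eqF ?old_gt0//.
by rewrite /slope; ring.
Qed.

Lemma apex_line u y :
  slope u * dot (w (inr u)) y =
  dot (w (foot u)) y + dot apex y * dot (w (foot u)) h.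
Proof.
rewrite [dot (w (foot u)) y]apex_coords subrK [LHS]mulrC.
rewrite -(sum_facets (fun u => dot (w (inr u)) y)); last first.
  by move=> u'; exact: facet_foot.
by rewrite dot_sumr; apply: eq_bigr => i _; rewrite dotZr.
Qed.

(** If all the e u vanished at a, then a would be a positive multiple of -apex.
    Take u whose foot is not a, which is possible as d > 1. By [apex_line] the
    foot of u is then a combination, with coefficients slope u >= 0 and > 0, of
    u and a, so it cannot be exposed. *)
Lemma facet_gt0 a : exists u, 0 < dot (w (inl a)) (e u).
Proof.
apply: contrapT => no_u.
have e0 u : dot (w (inl a)) (e u) = 0.
  apply/eqP; rewrite eq_le facet_ge0 andbT leNgt; apply/negP => eu.
  by apply: no_u; exists u.
have [|u ua] := clique_other (P := fun u => foot u = inl a) _.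
  by move=> u u' ua u'a; apply: foot_inj; rewrite ua u'a.
have [q qP] := realizes_vertex w_real (foot u).
have qu : 0 < dot (w (inr u)) q by exact: (qP _).2.
have q_foot : dot (w (foot u)) q = 0 by exact: (qP _).1.
have qa : 0 < dot (w (inl a)) q by apply: (qP _).2 => au; apply: ua.
have : 0 <= slope u * dot (w (inr u)) q by rewrite mulr_ge0 ?facet_ge0// ltW.
rewrite apex_line q_foot add0r pmulr_lge0 ?old_gt0// leNgt => /negP; apply.
rewrite -(pmulr_llt0 _ (old_gt0 a)) -oppr_gt0; move: qa.
by rewrite apex_coords big1 ?sub0r// => i _; rewrite e0 mulr0.
Qed.

Lemma slope_gt0 u : 0 < slope u.
Proof.
have [u' eu'] := facet_gt0 (@elem _ [set~ v] _ (clique_neq u)).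
have [uu'|/facet_foot e0] := pselect (u' = u); first by rewrite /slope -{2}uu'.
by move: eu'; rewrite e0 ltxx.
Qed.

(** In [apex_coords] all the terms are nonnegative, and by [facet_gt0] one of
    those coming from the clique is positive. *)
Lemma apex_beyond y a : (forall u, 0 < dot (w (inr u)) y) -> dot apex y <= 0 ->
  0 < dot (w (inl a)) y.
Proof.
move=> yK y_apex; have [inv nbK invK] := nb_bij; have [u eu] := facet_gt0 a.
rewrite apex_coords (bigD1 (inv u))//= invK -addrA ltr_pwDl ?mulr_gt0//.
rewrite addr_ge0 ?sumr_ge0// => [i _|].
  by rewrite mulr_ge0 ?facet_ge0// ltW.
by rewrite -mulNr mulr_ge0 ?oppr_ge0// ltW// old_gt0.
Qed.

Definition untruncation (k : G) : 'rV[R]_d.+1 :=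
  if pselect (k = v) is right kv then w (old kv) else apex.

Lemma untruncation_apex : untruncation v = apex.
Proof. by rewrite /untruncation; case: pselect. Qed.

Lemma untruncation_old (a : set_type [set~ v]) : untruncation (val a) = w (inl a).
Proof.
rewrite /untruncation; case: pselect => [/old_neq//|av].
by congr (w (inl _)); apply: val_inj.
Qed.

(** Going forth, c is positive at apex and nonnegative at the feet, so it is
    positive at the clique by [apex_line]. Going back, c is positive at apex by
    [apex_beyond], because it vanishes at a. *)
Lemma untruncation_face c (F : set G) (a : set_type [set~ v]) : ~ F v -> F (val a) ->
  (exposes untruncation c F <->
   exposes w c [set x | if x is inl b then F (val b) else False]).
Proof.
move=> nFv Fa; split=> cF.
  have c_foot u : 0 <= dot (w (foot u)) c.
    by rewrite -untruncation_old; apply: exposes_ge0 cF.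
  have c_apex : 0 < dot apex c by rewrite -untruncation_apex; apply: (cF v).2.
  move=> [b|u]; first by have := cF (val b); rewrite untruncation_old.
  split=> // _; rewrite -(pmulr_rgt0 _ (slope_gt0 u)) apex_line.
  by rewrite ltr_pwDr// mulr_gt0// old_gt0.
apply: (vertex_cases (v := v)) => [|b]; last first.
  by rewrite untruncation_old; apply: (cF (inl b)).
split=> // _; rewrite untruncation_apex ltNge; apply/negP => c_apex.
have := @apex_beyond c a _ c_apex; rewrite (cF (inl a)).1// ltxx.
by move=> /(_ (fun u => (cF (inr u)).2 id)).
Qed.

(** The sum of the e u vanishes at apex and is positive at the old vertices by
    [facet_gt0]. *)
Lemma untruncation_apex_exposed : exists c, exposes untruncation c [set v].
Proof.
pose c : 'cV[R]_d.+1 := \sum_i 1 *: e (nb i).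
have c_gt0 a : 0 < dot (w (inl a)) c.
  have [u eu] := facet_gt0 a; have [inv nbK invK] := nb_bij.
  rewrite dot_sumr (bigD1 (inv u))//= invK dotZr mul1r ltr_pwDl ?sumr_ge0// => i _.
  by rewrite dotZr mul1r facet_ge0.
exists c; apply: (vertex_cases (v := v)) => [|a]; last first.
  by rewrite untruncation_old; split=> [/old_neq|_] //.
split=> [_|[]//]; rewrite untruncation_apex /apex dotZl dotBl dotZl.
rewrite (@sum_facets (fun=> 1) u0 (inr u0)); last by move=> u'; exact: facet_other.
rewrite (@sum_facets (fun=> 1) u0 (foot u0)); last by move=> u'; exact: facet_foot.
by rewrite facet_self !mul1r mulr1 subrr mulr0.
Qed.

(** When u is the neighbor a of v, [apex_line] shows that the functionals
    exposing the edge from u to its foot vanish at apex. Conversely, if c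
    exposes {v, a} and a is not a neighbor of v, then c is positive at all the
    feet, hence at the clique by [apex_line], hence at a by [apex_beyond]. *)
Lemma untruncation_apex_adj (a : set_type [set~ v]) :
  adj v (val a) <-> exists c, exposes untruncation c [set v; val a].
Proof.
split=> [va|[c cP]]; last first.
  apply: contrapT => va.
  have ca : dot (w (inl a)) c = 0.
    by rewrite -untruncation_old; apply: (cP _).1; right.
  have c_apex : dot apex c = 0.
    by rewrite -untruncation_apex; apply: (cP _).1; left.
  suff : 0 < dot (w (inl a)) c by rewrite ca ltxx.
  apply: apex_beyond => [u|]; last by rewrite c_apex.
  rewrite -(pmulr_rgt0 _ (slope_gt0 u)) apex_line c_apex mul0r addr0.
  rewrite -untruncation_old; apply: (cP _).2 => -[/clique_neq//|ua].
  by apply: va; have := clique_adj u; have -> : val u = val a by [].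
pose u : set_type (neighbors v) := @elem _ (neighbors v) _ va.
have uf : (inr u : star_clique v) <> foot u by [].
have [/(_ (foot_adj u))[c cP] _] := realizes_edge w_real uf.
have footE : foot u = inl a by congr inl; apply: val_inj.
have c_foot : dot (w (foot u)) c = 0 by apply: (cP _).1; right.
have cu : dot (w (inr u)) c = 0 by apply: (cP _).1; left.
exists c; apply: (vertex_cases (v := v)) => [|b].
  split=> [_|]; last by case; left.
  have := apex_line u c; rewrite c_foot cu mulr0 add0r => /esym/eqP.
  by rewrite mulf_eq0 (gt_eqF (old_gt0 _)) orbF untruncation_apex => /eqP.
rewrite untruncation_old; split=> [[/old_neq//|/val_inj ->]|nb']; first by rewrite -footE.
apply: (cP _).2 => -[//|]; rewrite /= footE => -[ba]; apply: nb'; right.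
by rewrite ba.
Qed.

Lemma finite_untruncation : finite_set [set: G].
Proof.
pose f (x : star_clique v) : G := if x is inl a then val a else v.
have := finite_image f (realizes_finite w_real); apply: sub_finite_set.
by move=> + _; apply: (vertex_cases (v := v)) => [|a]; [exists (inr u0) | exists (inl a)].
Qed.

Lemma untruncation_realizes : realizes untruncation.
Proof.
split.
- exact: finite_untruncation.
- move=> c c0; apply: (realizes_separating w_real) => -[a|u].
    by rewrite -untruncation_old.
  apply/eqP; have := apex_line u c; rewrite -untruncation_old -untruncation_apex !c0.
  by rewrite mul0r addr0 => /eqP; rewrite mulf_eq0 gt_eqF ?slope_gt0.
- have [c cP] := untruncation_apex_exposed.
  have h_apex : dot (untruncation v) (- h) = 1.
    rewrite untruncation_apex /apex dotZl dotNr dotBl dotZl clique_eq0 mulr0 sub0r opprK.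
    by rewrite mulVf// gt_eqF// old_gt0.
  (* -h is positive at apex: tilting a functional that exposes apex by -h makes
     it positive everywhere. *)
  have [|M MP] := exposes_perturb finite_untruncation cP (y := - h).
    by move=> k ->; rewrite h_apex.
  exists (M *: c + - h).
  suff <- : [set v] `&` [set k | dot (untruncation k) (- h) = 0] = set0 by [].
  apply/seteqP; split=> // k [/= ->]; rewrite h_apex => /eqP.
  by rewrite oner_eq0.
- apply: (vertex_cases (v := v)) => [|a]; first exact: untruncation_apex_exposed.
  have [c cP] := realizes_vertex w_real (inl a); exists c.
  apply/(@untruncation_face c _ a) => //; first by move/esym/old_neq.
  suff -> : [set x : star_clique v | if x is inl b then [set val a] (val b) else False] =
            [set inl a] by [].
  by apply/seteqP; split=> [[b|//] /val_inj ->|_ ->].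
apply: (vertex_cases (v := v)) => [|a]; apply: (vertex_cases (v := v)) => [//|b ab].
- exact: untruncation_apex_adj.
- rewrite setUC -untruncation_apex_adj.
  by split; apply: adj_sym.
have abE : (inl a : star_clique v) <> inl b by move=> [] E; apply: ab; rewrite E.
have -> : adj (val a) (val b) = adj (inl a : star_clique v) (inl b) by [].
rewrite (realizes_edge w_real abE).
have E : [set x : star_clique v | if x is inl k then [set val a; val b] (val k) else False] =
            [set inl a; inl b].
  apply/seteqP; split=> [[k|//] [/val_inj ->|/val_inj ->]|_ [->|->]];
    by [left|right].
by split=> -[c cP]; exists c; move: cP;
  rewrite (@untruncation_face c _ a) ?E//=; do ?[by left]; move=> [/esym/old_neq|/esym/old_neq].
Qed.

End Untruncation.

(** * Convex hulls and their faces *)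

Section Hulls.
Variables (R : realType) (n : nat).
Implicit Types (A P F : set 'rV[R]_n) (x y z : 'rV[R]_n).

(** Homogeneous coordinates turn affine functions into linear functionals. *)
Definition lift_row x : 'rV[R]_(1 + n) := row_mx 1%:M x.

Lemma lift_comb k (p : 'I_k -> 'rV[R]_n) (a : 'I_k -> R) : \sum_i a i = 1 ->
  lift_row (\sum_i a i *: p i) = \sum_i a i *: lift_row (p i).
Proof.
move=> a1; rewrite /lift_row -[RHS]hsubmxK !linear_sum/=; congr row_mx.
  under eq_bigr => i _ do rewrite linearZ/= row_mxKl.
  by rewrite -scaler_suml a1 scale1r.
by apply: eq_bigr => i _; rewrite linearZ/= row_mxKr.
Qed.

Lemma dot_lift x f : dot (lift_row x) f = f 0 0 + dot x (dsubmx f).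
Proof.
rewrite /dot /lift_row -{1}[f]vsubmxK mul_row_col mul1mx mxE; congr (_ + _).
by rewrite mxE; congr (f _ _); apply: val_inj.
Qed.

Definition affine_form (c : 'cV[R]_n) (b : R) : 'cV[R]_(1 + n) := col_mx b%:M (- c).

Lemma dot_affine_form x c b : dot (lift_row x) (affine_form c b) = b - dot x c.
Proof. by rewrite /dot /lift_row mul_row_col mul1mx mulmxN !mxE eqxx. Qed.

Lemma conv_aff A : conv_hull A `<=` aff_hull A.
Proof. by move=> x [k [p [a [Ap _ a1 ->]]]]; exists k, p, a. Qed.

Lemma sub_conv A : A `<=` conv_hull A.
Proof.
move=> x Ax; exists 1%N, (fun=> x), (fun=> 1).
by split=> //; rewrite big_ord1 ?scale1r.
Qed.

Lemma sub_aff A : A `<=` aff_hull A.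
Proof. by move=> x /sub_conv /conv_aff. Qed.

Lemma conv_nonempty A x : conv_hull A x -> exists a, A a.
Proof.
move=> [[|k] [p [a [Ap _ a1 _]]]]; last by exists (p ord0).
by move: a1; rewrite big_ord0 => /esym/eqP; rewrite oner_eq0.
Qed.

Lemma conv_ge0 A f x : (forall a, A a -> 0 <= dot (lift_row a) f) ->
  conv_hull A x -> 0 <= dot (lift_row x) f.
Proof.
move=> fA [k [p [a [Ap a0 a1 ->]]]]; rewrite lift_comb// dot_suml sumr_ge0// => i _.
by rewrite dotZl mulr_ge0// fA.
Qed.

Lemma aff_eq0 A f x : (forall a, A a -> dot (lift_row a) f = 0) ->
  aff_hull A x -> dot (lift_row x) f = 0.
Proof.
move=> fA [k [p [a [Ap a1 ->]]]]; rewrite lift_comb// dot_suml big1// => i _.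
by rewrite dotZl fA// mulr0.
Qed.

(** In a convex combination on which f vanishes, each point with a nonzero
    coefficient is a zero of f. *)
Lemma conv_zeros A f x : (forall a, A a -> 0 <= dot (lift_row a) f) ->
  conv_hull A x -> dot (lift_row x) f = 0 ->
  conv_hull (A `&` [set a | dot (lift_row a) f = 0]) x.
Proof.
move=> fA [k [p [a [Ap a0 a1 ->]]]]; rewrite lift_comb// dot_suml => fx.
have f0 i : a i != 0 -> dot (lift_row (p i)) f = 0.
  have a_f_ge0 j : true -> 0 <= dot (a j *: lift_row (p j)) f.
    by move=> _; rewrite dotZl mulr_ge0// fA.
  move=> ai; have /eqP := psumr_eq0P a_f_ge0 fx (i := i) isT.
  by rewrite dotZl mulf_eq0 (negPf ai) => /eqP.
have [i0 ai0] : exists i0, a i0 != 0.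
  apply: contrapT => /forallNP a_eq0; move: a1; rewrite big1.
    by move=> /esym/eqP; rewrite oner_eq0.
  by move=> i _; apply/eqP/negPn/negP.
(* Points with coefficient 0 need not be zeros of f; they are replaced by p i0. *)
exists k, (fun i => if a i == 0 then p i0 else p i), a; split=> //.
- by move=> i; case: eqVneq => ai; split=> //; apply: f0.
- by apply: eq_bigr => i _; case: eqVneq => // ->; rewrite !scale0r.
Qed.

Definition line x y : set 'rV[R]_n := [set z | exists t, z = x + t *: (y - x)].

Lemma line_l x y : line x y x.
Proof. by exists 0; rewrite scale0r addr0. Qed.

Lemma line_r x y : line x y y.
Proof. by exists 1; rewrite scale1r addrC subrK. Qed.

Lemma aff_line x y A : A `<=` line x y -> aff_hull A `<=` line x y.
Proof.
move=> Al _ [k [p [a [Ap a1 ->]]]].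
have /choice[t tP] i : exists t, p i = x + t *: (y - x) by apply/Al.
exists (\sum_i a i * t i).
under eq_bigr => i _ do rewrite tP scalerDr scalerA.
by rewrite big_split/= -!scaler_suml a1 scale1r.
Qed.

Lemma has_dim1_line F x y : has_dim F 1 -> F x -> F y -> x <> y -> F `<=` line x y.
Proof.
move=> [x0 [U [affF dimU]]] Fx Fy xy z Fz.
have inU z' : F z' -> exists2 u, u \in U & z' = x0 + u.
  by move=> /sub_aff; rewrite affF => -[u uU <-]; exists u.
have [[u uU xE] [u' u'U yE]] := (inU x Fx, inU y Fy).
have [u'' u''U zE] := inU z Fz.
have diffE a b : (x0 + a) - (x0 + b) = a - b by rewrite opprD addrACA subrr add0r.
have UE : <[y - x]>%VS = U.
  apply/eqP; rewrite eqEdim dimU dim_vline subr_eq0 -memvE yE xE diffE memvB//=.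
  by rewrite -xE -yE; case: eqP => // yx; case: xy.
have /vlineP[t zx] : z - x \in <[y - x]>%VS by rewrite UE zE xE diffE memvB.
by exists t; rewrite -zx [RHS]addrC subrK.
Qed.

Lemma line_has_dim1 F x y : F x -> F y -> x <> y -> F `<=` line x y -> has_dim F 1.
Proof.
move=> Fx Fy xy Fl; exists x, <[y - x]>%VS; split; last first.
  by rewrite dim_vline subr_eq0; case: eqP => // yx; case: xy.
apply/seteqP; split=> [z /(aff_line Fl)[t ->]|_ [u /vlineP[t ->] <-]].
  by exists (t *: (y - x)) => //=; apply/vlineP; exists t.
exists 2, (fun i => if i == ord0 then x else y), (fun i => if i == ord0 then 1 - t else t).
split=> [i||]; first by case: ifP.
  by rewrite big_ord_recl big_ord1/= subrK.
rewrite big_ord_recl big_ord1/= scalerBl scale1r scalerBr.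
by rewrite addrAC -addrA.
Qed.

Lemma conv_face A f : (forall a, A a -> 0 <= dot (lift_row a) f) ->
  face (conv_hull A) (conv_hull A `&` [set x | dot (lift_row x) f = 0]).
Proof.
move=> fA; exists (- dsubmx f), (f 0 0); split=> [x /(conv_ge0 fA)|].
  by rewrite dot_lift -/(dot _ _) dotNr; lra.
apply/seteqP; split=> x [Px /=]; rewrite dot_lift -/(dot _ _) dotNr => fx;
  by split=> //=; lra.
Qed.

Lemma face_form P F : face P F ->
  exists f, (forall x, P x -> 0 <= dot (lift_row x) f) /\
    F = P `&` [set x | dot (lift_row x) f = 0].
Proof.
move=> [c [b [cb ->]]]; exists (affine_form c b); split=> [x Px|].
  by rewrite dot_affine_form subr_ge0 cb.
apply/seteqP; split=> x [Px /=]; rewrite dot_affine_form -/(dot _ _).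
  by move=> ->; rewrite subrr.
by move=> /subr0_eq ->.
Qed.

Lemma conv_vertex A f z : (forall a, A a -> 0 <= dot (lift_row a) f) -> A z ->
  dot (lift_row z) f = 0 ->
  (forall a, A a -> dot (lift_row a) f = 0 -> a = z) -> vertices (conv_hull A) z.
Proof.
move=> fA Az fz f_only; have := conv_face fA.
suff -> : conv_hull A `&` [set x | dot (lift_row x) f = 0] = [set z] by [].
apply/seteqP; split=> [x [Ax /= fx]|_ ->]; last by split=> //; exact: sub_conv.
have Al : A `&` [set a | dot (lift_row a) f = 0] `<=` line z z.
  by move=> a [Aa /= fa]; rewrite (f_only a)//; exact: line_l.
have [t ->] := aff_line Al (conv_aff (conv_zeros fA Ax fx)).
by rewrite subrr scaler0 addr0.
Qed.

Lemma vertices_sub A : vertices (conv_hull A) `<=` A.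
Proof.
move=> x /face_form[f [f_ge0 xE]].
have [Px /= fx] : (conv_hull A `&` [set x | dot (lift_row x) f = 0]) x by rewrite -xE.
have fA a : A a -> 0 <= dot (lift_row a) f by move=> /sub_conv/f_ge0.
have [a [Aa /= fa]] := conv_nonempty (conv_zeros fA Px fx).
suff <- : a = x by [].
by have : [set x] a by rewrite xE; split=> //; exact: sub_conv.
Qed.

(** The values of f on A are minimal on an exposed face reduced to one point,
    by [exposed_min], and such a point is a vertex. *)
Lemma conv_min A f : finite_set A -> (exists a, A a) ->
  exists2 z, vertices (conv_hull A) z &
    forall a, A a -> dot (lift_row z) f <= dot (lift_row a) f.
Proof.
move=> finA [a0 Aa0].
pose w (a : set_type A) := lift_row (val a).
have finT : finite_set [set: set_type A].
  by apply: (card_le_finite _ finA); rewrite (card_le_eql (card_setT A)).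
have w1 a : dot (w a) (affine_form 0 1) = 1.
  by rewrite dot_affine_form dot0r subr0.
pose l a (Aa : A a) : set_type A := @elem _ A _ Aa.
have [k [c [cP min_k]]] := exposed_min finT f (l a0 Aa0) w1.
exists (val k); last by move=> a Aa; exact: (min_k (l a Aa)).
have cA a (Aa : A a) := exposes_ge0 (l a Aa) cP.
apply: (conv_vertex (f := c)) => //; first exact: (set_mem (valP k)).
  exact: (cP k).1.
move=> a Aa ca; have /= := exposes_eq0 cP (k := l a Aa) ca.
by rewrite /w /lift_row => /eq_row_mx[].
Qed.

Lemma conv_vertices_ge0 A f : finite_set A ->
  (forall z, vertices (conv_hull A) z -> 0 <= dot (lift_row z) f) ->
  forall a, A a -> 0 <= dot (lift_row a) f.
Proof.
move=> finA f_ge0 a Aa; have [|z Vz min_z] := conv_min f finA; first by exists a.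
by apply: le_trans (min_z a Aa); apply: f_ge0.
Qed.

(** Outside the line, (1, a) is not in the span of (1, x) and (1, y). *)
Lemma line_form x y a : ~ line x y a ->
  exists g, [/\ dot (lift_row x) g = 0, dot (lift_row y) g = 0 &
                dot (lift_row a) g < 0].
Proof.
move=> axy; pose M := col_mx (lift_row x) (lift_row y).
have dot_col (z : 'rV[R]_(1 + n)) j (K : 'M_(1 + n)) : dot z (col j K) = (z *m K) 0 j.
  by rewrite /dot colE mulmxA -colE mxE.
have : ~~ (lift_row a <= M)%MS.
  apply/negP => /submxP[D]; rewrite -[D]hsubmxK /M mul_row_col => aE; apply: axy.
  move: aE; rewrite [lsubmx D]mx11_scalar [rsubmx D]mx11_scalar !mul_scalar_mx.
  set s := lsubmx D 0 0; set t := rsubmx D 0 0.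
  rewrite /lift_row !scale_row_mx add_row_mx => /eq_row_mx[/matrixP/(_ 0 0)].
  rewrite !mxE eqxx !mulr1 => st ->; exists t.
  have -> : s = 1 - t by rewrite [X in X - t]st addrK.
  by rewrite scalerBl scale1r scalerBr addrAC -addrA.
rewrite submxE => /rV0Pn[j]; rewrite -dot_col; set g := col j _ => ag.
have : M *m cokermx M = 0 by rewrite mulmx_coker.
rewrite {1}/M mul_col_mx => /eqP; rewrite col_mx_eq0 => /andP[/eqP xK /eqP yK].
have gx : dot (lift_row x) g = 0 by rewrite dot_col xK mxE.
have gy : dot (lift_row y) g = 0 by rewrite dot_col yK mxE.
exists (- dot (lift_row a) g *: g); rewrite !dotZr gx gy !mulr0.
by split=> //; rewrite mulNr oppr_lt0 -expr2 exprn_even_gt0.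
Qed.

End Hulls.

(** * Polytopes and realizations *)

(** Q takes coordinates in the affine hull of P with respect to a point x0 and
    a basis of its direction, and S goes back. Passing to coordinates makes the
    functionals that vanish on P zero, whatever the ambient dimension n is. *)
Lemma affine_coordinates (R : realType) n (P : set 'rV[R]_n) d : has_dim P d ->
  exists (Q : 'M[R]_(1 + n, 1 + d)) (S : 'M[R]_(1 + d, 1 + n)),
    (forall x, P x -> lift_row x *m Q *m S = lift_row x) /\
    (forall e, (forall x, aff_hull P x -> dot (lift_row x *m Q) e = 0) -> e = 0).
Proof.
move=> [x0 [U [affP <-]]].
pose B : 'M[R]_(\dim U, n) := \matrix_(i < \dim U) (vbasis U)`_i.
have mulB (a : 'rV_(\dim U)) : a *m B = \sum_i a 0 i *: (vbasis U)`_i.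
  by rewrite mulmx_sum_row; apply: eq_bigr => i _; rewrite rowK.
have [C BC] : exists C, B *m C = 1%:M.
  apply/row_freeP; rewrite -kermx_eq0; apply/rowV0P => a /sub_kermxP.
  rewrite mulB => aB0; apply/rowP => i; rewrite mxE.
  by apply: (freeP (basis_free (vbasisP U)) (a 0)).
have liftQ x : lift_row x *m block_mx 1%:M (- (x0 *m C)) 0 C =
    row_mx 1%:M ((x - x0) *m C).
  by rewrite mul_row_block !mul1mx mulmx0 addr0 mulmxBl addrC.
exists (block_mx 1%:M (- (x0 *m C)) 0 C), (block_mx 1%:M x0 0 B); split=> [x Px|e e0].
  have [u Uu xE] : exists2 u, u \in U & x0 + u = x.
    by move: (sub_aff Px); rewrite affP => -[u uU <-]; exists u.
  rewrite liftQ mul_row_block !mul1mx mulmx0 addr0 -xE addrAC subrr add0r.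
  rewrite /lift_row; congr (row_mx _ (_ + _)).
  have -> : u = (\row_i coord (vbasis U) i u) *m B.
    by rewrite mulB {1}(coord_vbasis Uu); apply: eq_bigr => i _; rewrite mxE.
  by rewrite -mulmxA -mulmxA (mulmxA B) BC mul1mx.
have e0' (a : 'rV_(\dim U)) : row_mx 1%:M a *m e = 0.
  have aff_a : aff_hull P (x0 + a *m B).
    rewrite affP; exists (a *m B) => //=; rewrite mulB memv_suml// => i _.
    by rewrite memvZ// vbasis_mem// mem_nth// size_tuple.
  have := e0 _ aff_a; rewrite liftQ addrAC subrr add0r -mulmxA BC mulmx1 => ae.
  by apply/matrixP => i j; rewrite !ord1 [RHS]mxE.
have u0 : usubmx e = 0.
  by have := e0' 0; rewrite -[e]vsubmxK mul_row_col mul1mx mul0mx addr0 col_mxKu.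
rewrite -[e]vsubmxK u0; suff -> : dsubmx e = 0 by rewrite col_mx0.
apply/row_matrixP => i; rewrite row0 rowE; have := e0' (delta_mx 0 i).
by rewrite -{1}[e]vsubmxK mul_row_col u0 mulmx0 add0r.
Qed.

Lemma edge_line (R : realType) n (P F : set 'rV[R]_n) (x y z : 'rV[R]_n) :
  edge P F -> F x -> F y -> x <> y -> F z -> line x y z.
Proof. by move=> [_ dimF] Fx Fy xy; apply: has_dim1_line dimF _ _ _ _. Qed.

Section PolytopeToConfiguration.
Variables (R : realType) (n d : nat) (A : set 'rV[R]_n).
Hypotheses (finA : finite_set A) (dimP : has_dim (conv_hull A) d).

Let P := conv_hull A.

Lemma vertices_conv z : vertices P z -> P z.
Proof. by move=> /vertices_sub; exact: sub_conv. Qed.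

(** The face of f contains no point of A outside the line through x and y: a
    form that vanishes at x and y and is negative at such a point a, added to a
    large multiple of f, would be nonnegative at all the vertices of P but
    negative at a, against [conv_vertices_ge0]. *)
Lemma edge_face (x y : 'rV[R]_n) f : x <> y -> vertices P x -> vertices P y ->
  (forall z, vertices P z -> 0 <= dot (lift_row z) f) ->
  (forall z, vertices P z -> dot (lift_row z) f = 0 <-> (z = x \/ z = y)) ->
  exists F, [/\ edge P F, F x & F y].
Proof.
move=> xy Vx Vy f_ge0 f0.
have fx := (f0 x Vx).2 (or_introl erefl); have fy := (f0 y Vy).2 (or_intror erefl).
have fA := conv_vertices_ge0 finA f_ge0.
exists (P `&` [set z | dot (lift_row z) f = 0]).
have Fx : (P `&` [set z | dot (lift_row z) f = 0]) x.
  by split=> //; apply: vertices_conv.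
have Fy : (P `&` [set z | dot (lift_row z) f = 0]) y.
  by split=> //; apply: vertices_conv.
split=> //; split; first exact: conv_face.
apply: line_has_dim1 Fx Fy xy _ => z [Pz /= fz].
apply: (aff_line _ (conv_aff (conv_zeros fA Pz fz))) => a [Aa /= fa].
apply: contrapT => /line_form[g [gx gy ga]].
pose w (z : set_type (vertices P)) := lift_row (val z).
have finV : finite_set [set: set_type (vertices P)].
  by apply: finite_set_type; apply: sub_finite_set finA; exact: vertices_sub.
have wf : exposes w f [set z | val z = x \/ val z = y].
  move=> [z' /= Vz']; have := f0 z' (set_mem Vz'); rewrite /w /= => fz'.
  split=> [/fz'//|nz]; rewrite lt_neqAle f_ge0 ?andbT; last exact: (set_mem Vz').
  by rewrite eq_sym; apply/eqP => /fz'.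
have [|M wM] := exposes_perturb finV wf (y := g).
  by rewrite /w => z' /= [->|->]; rewrite ?gx ?gy.
suff : 0 <= dot (lift_row a) (M *: f + g) by rewrite dotDr dotZr fa mulr0 add0r leNgt ga.
apply: (conv_vertices_ge0 finA) => // z' Vz'.
exact: (exposes_ge0 (@elem _ (vertices P) _ Vz') wM).
Qed.

Lemma polytope_realizes : exists w : polytope_graph P -> 'rV[R]_d.+1, realizes w.
Proof.
have [Q [S [QS Qsep]]] := affine_coordinates dimP.
pose w (z : polytope_graph P) : 'rV[R]_d.+1 := lift_row (val z) *m Q.
have Vz (z : polytope_graph P) : vertices P (val z) by exact: set_mem (valP z).
have Pz (z : polytope_graph P) : P (val z) by apply: vertices_conv; apply: Vz.
have wS (z : polytope_graph P) f : dot (w z) (S *m f) = dot (lift_row (val z)) f.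
  by rewrite -dot_mulmx QS//; apply: Pz.
have vert z : exists c, exposes w c [set z].
  have [f [f_ge0 zE]] := face_form (Vz z).
  exists (S *m f) => z'; rewrite wS /=; split=> [->|z'z].
    by have [] : (P `&` [set x | dot (lift_row x) f = 0]) (val z) by rewrite -zE.
  rewrite lt_neqAle f_ge0 ?andbT; last exact: Pz.
  apply/eqP => /esym fz'; apply: z'z; apply: val_inj.
  by have : [set val z] (val z') by rewrite zE; split=> //; apply: Pz.
exists w; split=> //.
- by apply: finite_set_type; apply: sub_finite_set finA; exact: vertices_sub.
- move=> c c0; apply: Qsep => x aff_x; rewrite dot_mulmx.
  have c0' s : forall z, vertices P z -> 0 <= dot (lift_row z) (s *: (Q *m c)).
    move=> z zV; have := c0 (@elem _ (vertices P) _ zV).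
    by rewrite dotZr -dot_mulmx /w /= => ->; rewrite mulr0.
  have cA a : A a -> dot (lift_row a) (Q *m c) = 0.
    move=> Aa; apply/eqP; rewrite eq_le -oppr_ge0 -dotNr -scaleN1r.
    by rewrite -{2}[Q *m c]scale1r !(conv_vertices_ge0 finA (c0' _)).
  have cP a : P a -> dot (lift_row a) (Q *m c) = 0.
    by move=> /conv_aff; apply: aff_eq0.
  exact: aff_eq0 aff_x.
- exists (S *m affine_form 0 1) => z; split=> // _.
  by rewrite wS dot_affine_form dot0r subr0.
move=> x y xy; split=> [[_ [F [FE Fx Fy]]]|[c cP]].
  have [f [f_ge0 FE']] := face_form FE.1.
  have F0 z : P z -> dot (lift_row z) f = 0 -> F z by move=> ? fz; rewrite FE'.
  have f0 z : F z -> dot (lift_row z) f = 0 by rewrite FE' => -[].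
  exists (S *m f) => z; rewrite wS; split=> [[->|->]|nz]; [exact: f0|exact: f0|].
  rewrite lt_neqAle f_ge0 ?andbT; last exact: Pz.
  apply/eqP => /esym fz; apply: nz.
  have Fz : F (val z) by apply: F0 => //; apply: Pz.
  have [t zE] := edge_line FE Fx Fy (fun E => xy (val_inj E)) Fz.
  apply: (exposed_collinear vert (t := t)).
  rewrite /w zE -mulmxBl scalemxAl -mulmxDl; congr (_ *m Q).
  rewrite /lift_row opp_row_mx add_row_mx subrr scale_row_mx scaler0 add_row_mx.
  by rewrite addr0.
split=> //; apply: (edge_face (f := Q *m c)) => //.
- by move=> /val_inj.
- move=> z zV; rewrite -dot_mulmx.
  exact: (exposes_ge0 (@elem _ (vertices P) _ zV) cP).
move=> z zV; pose z' : polytope_graph P := @elem _ (vertices P) _ zV.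
rewrite -dot_mulmx; split=> [wz|].
  by have [/(congr1 val)|/(congr1 val)] := exposes_eq0 cP (k := z') wz; [left|right].
by move=> zxy; apply: (cP z').1; case: zxy => E; [left|right]; apply: val_inj.
Qed.

End PolytopeToConfiguration.

(** If the functional p is 1 on all the vectors, their convex hull is a polytope
    in the hyperplane p = 1, of dimension d because the vectors span R^(d+1).
    On this hyperplane affine and linear functionals agree. *)
Section ConfigurationToPolytope.
Variables (R : realType) (d : nat) (G : sgraph) (w : G -> 'rV[R]_d.+1).
Hypothesis w_real : realizes w.
Variable p : 'cV[R]_d.+1.
Hypothesis w1 : forall k, dot (w k) p = 1.

Let P := conv_hull (range w).

Lemma range_finite : finite_set (range w).
Proof. exact: finite_image (realizes_finite w_real). Qed.

Lemma lift_linear x (c : 'cV[R]_d.+1) : dot (lift_row x) (affine_form (- c) 0) = dot x c.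
Proof. by rewrite dot_affine_form dotNr sub0r opprK. Qed.

Lemma exposes_range c F : exposes w c F -> forall a, range w a ->
  0 <= dot (lift_row a) (affine_form (- c) 0).
Proof. by move=> cF _ [k _ <-]; rewrite lift_linear; apply: exposes_ge0 cF. Qed.

Lemma hull_vertex k : vertices P (w k).
Proof.
have [c cP] := realizes_vertex w_real k.
apply: (conv_vertex (exposes_range cP)); first by exists k.
  by rewrite lift_linear; apply: (cP k).1.
by move=> _ [j _ <-]; rewrite lift_linear => /(exposes_eq0 cP) ->.
Qed.

Lemma hull_vertex_inj : injective w.
Proof.
move=> j k wjk; have [c cP] := realizes_vertex w_real k.
by apply: (exposes_eq0 cP); rewrite wjk (cP k).1.
Qed.

Lemma range_span (x : 'rV[R]_d.+1) : dot x p = 1 -> aff_hull P x.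
Proof.
move=> xp; have [n [g g_surj]] := finite_enum (realizes_finite w_real).
pose W : 'M[R]_(n, d.+1) := \matrix_(i < n) w (g i).
have [B BW] : exists B, B *m W = 1%:M.
  apply/row_fullP; rewrite /row_full -mxrank_tr -/(row_free _) -kermx_eq0.
  apply/rowV0P => a /sub_kermxP aW; apply: trmx_inj; rewrite trmx0.
  apply: (realizes_separating w_real) => k; have [i <-] := g_surj k.
  rewrite -[w (g i)](rowK (fun i => w (g i))) -/W /dot -row_mul mxE.
  by rewrite -[W]trmxK -trmx_mul aW trmx0 mxE.
have xE : x = \sum_i (x *m B) 0 i *: w (g i).
  rewrite -[LHS]mulmx1 -BW mulmxA mulmx_sum_row.
  by apply: eq_bigr => i _; rewrite rowK.
exists n, (w \o g), (fun i => (x *m B) 0 i); split=> // [i|].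
  by apply: sub_conv; exists (g i).
rewrite -[RHS]xp [X in dot X _]xE dot_suml.
by apply: eq_bigr => i _; rewrite dotZl w1 mulr1.
Qed.

Lemma hull_dim (k0 : G) : has_dim P d.
Proof.
pose phi : 'Hom('rV[R]_d.+1, 'M[R]_1) := linfun (mulmxr p).
have phiE x : phi x = (dot x p)%:M by rewrite lfunE/= [LHS]mx11_scalar.
exists (w k0), (lker phi); split; last first.
  have := limg_ker_dim phi fullv; rewrite capfv dimvf dim_matrix mul1r.
  suff -> : \dim (limg phi) = 1%N by rewrite addn1 => -[].
  apply/eqP; rewrite eqn_leq; apply/andP; split.
    by rewrite (leq_trans (dimvS (subvf _)))// dimvf dim_matrix.
  rewrite lt0n dimv_eq0; apply/eqP => phi0.
  have : phi (w k0) \in limg phi by rewrite memv_img ?memvf.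
  rewrite phi0 memv0 phiE w1 => /eqP/matrixP/(_ 0 0)/eqP.
  by rewrite !mxE eqxx oner_eq0.
have P1 x : P x -> dot (lift_row x) (affine_form (- p) (- 1)) = 0.
  move=> /conv_aff; apply: aff_eq0 => _ [k _ <-].
  by rewrite dot_affine_form dotNr w1 opprK addNr.
apply/seteqP; split=> [x /(aff_eq0 P1)|_ [u /= + <-]].
  rewrite dot_affine_form dotNr opprK addrC => /subr0_eq xp.
  exists (x - w k0); last by rewrite addrC subrK.
  by rewrite /= memv_ker phiE dotBl xp w1 subrr raddf0.
rewrite memv_ker phiE => /eqP/matrixP/(_ 0 0); rewrite !mxE eqxx mulr1n => u0.
by apply: range_span; rewrite dotDl w1 u0 addr0.
Qed.

(** By [exposed_collinear], a face of dimension 1 through two of the vectors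
    contains no third one, so that the functional cutting it out exposes just
    these two. *)
Lemma hull_graph : isograph G (polytope_graph P).
Proof.
pose f k : polytope_graph P := @elem _ (vertices P) _ (hull_vertex k).
have f_inj : injective f by move=> j k /(congr1 val)/hull_vertex_inj.
exists f.
  have /choice[g gP] (x : polytope_graph P) : exists k, f k = x.
    have [k _ wk] := vertices_sub (set_mem (valP x) : vertices P (val x)).
    by exists k; apply: val_inj.
  by exists g => // k; apply: f_inj; rewrite gP.
move=> j k; have [jk|jk] := pselect (j = k).
  by rewrite jk; split=> [/adj_irrefl|[]].
rewrite (realizes_edge w_real jk); split=> [[c cP]|[_ [F [FE Fj Fk]]]].
  have fc0 (a : 'rV_d.+1) :
      (range w `&` [set a | dot (lift_row a) (affine_form (- c) 0) = 0]) a ->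
      a = w j \/ a = w k.
    move=> [[i _ <-] /=]; rewrite lift_linear => /(exposes_eq0 cP) [->|->]; by [left|right].
  split; first by move/f_inj.
  set f0 := affine_form (- c) 0 in fc0.
  exists (P `&` [set x | dot (lift_row x) f0 = 0]).
  have F_in i : [set j; k] i -> (P `&` [set x | dot (lift_row x) f0 = 0]) (w i).
    move=> jki; split; first by apply: sub_conv; exists i.
    by rewrite /= lift_linear (cP i).1.
  have Fj := F_in j (or_introl erefl); have Fk := F_in k (or_intror erefl).
  split=> //; split; first exact: conv_face (exposes_range cP).
  apply: line_has_dim1 Fj Fk _ _; first by move/hull_vertex_inj.
  move=> x [Px /= fx].
  apply: (aff_line _ (conv_aff (conv_zeros (exposes_range cP) Px fx))).
  by move=> a /fc0[->|->]; [exact: line_l | exact: line_r].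
have [c [b [cb FE']]] := FE.1.
have wc i : dot (w i) (b *: p - c) = b - dot (w i) c by rewrite dotBr dotZr w1 mulr1.
have Pw i : P (w i) by apply: sub_conv; exists i.
have wc_ge0 i : 0 <= dot (w i) (b *: p - c) by rewrite wc subr_ge0; apply: cb.
exists (b *: p - c); suff -> : [set j; k] = [set i | dot (w i) (b *: p - c) = 0].
  exact: exposes_zeros.
apply/seteqP; split=> i /=; rewrite wc.
  by move: Fj Fk; rewrite FE' /= => -[_ wj] [_ wk] [->|->]; rewrite /dot ?wj ?wk subrr.
move=> /subr0_eq wi; have Fi : F (w i) by rewrite FE'.
have [t wE] := edge_line FE Fj Fk (fun E => jk (hull_vertex_inj E)) Fi.
exact: (exposed_collinear (realizes_vertex w_real) wE).
Qed.

End ConfigurationToPolytope.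

Lemma realizes_scale (R : realType) d (G : sgraph) (w : G -> 'rV[R]_d.+1)
    (s : G -> R) :
  (forall k, 0 < s k) -> realizes w -> realizes (fun k => s k *: w k).
Proof.
move=> s_gt0 [fin sep pos vert edge].
have expE c F : exposes (fun k => s k *: w k) c F <-> exposes w c F.
  split=> cF k; have [c0 cp] := cF k; split=> [Fk|nFk].
  - have /eqP := c0 Fk; rewrite dotZl mulf_eq0 gt_eqF//=.
    by move/eqP.
  - by have := cp nFk; rewrite dotZl pmulr_rgt0.
  - by rewrite dotZl c0// mulr0.
  - by rewrite dotZl mulr_gt0// cp.
split=> //.
- move=> c c0; apply: sep => k; apply/eqP; have /eqP := c0 k.
  by rewrite dotZl mulf_eq0 gt_eqF.
- by have [c cP] := pos; exists c; apply/expE.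
- by move=> v; have [c cP] := vert v; exists c; apply/expE.
move=> u v uv; rewrite edge//.
by split=> -[c cP]; exists c; apply/expE.
Qed.

Lemma polytopal_realizes (R : realType) d (G : sgraph) :
  polytopal R d G <-> exists w : G -> 'rV[R]_d.+1, realizes w.
Proof.
split=> [[n [P [[A finA ->] dimP [f f_bij f_adj]]]]|[w w_real]].
  have [w w_real] := polytope_realizes finA dimP.
  by exists (w \o f); apply: realizes_isograph.
have [p pP] := realizes_positive w_real.
have p_gt0 k : 0 < dot (w k) p by apply: (pP k).2.
pose z k := (dot (w k) p)^-1 *: w k.
have z_real : realizes z by apply: realizes_scale => // k; rewrite invr_gt0.
have z1 k : dot (z k) p = 1 by rewrite dotZl mulVf// gt_eqF.
exists d.+1, (conv_hull (range z)); split.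
- by exists (range z); first exact: range_finite.
- have [[k0 _]|noG] := pselect (exists k : G, True); first exact: hull_dim z1 k0.
  have : const_mx 1 = 0 :> 'cV[R]_d.+1.
    by apply: (realizes_separating w_real) => k; case: noG; exists k.
  by move=> /matrixP/(_ 0 0)/eqP; rewrite !mxE oner_eq0.
- exact: hull_graph z1.
Qed.

(** For d = 1 the clique is a single vertex, which takes the place of v. *)
Lemma star_clique1 (G : sgraph) (v : G) : has_degree v 1 -> isograph G (star_clique v).
Proof.
move=> hv; have [nb [inv _ nbK]] := degree_enum hv.
pose u0 := nb ord0.
have all_u0 u : u = u0 by rewrite -[u]nbK (ord1 (inv u)).
pose f k : star_clique v := if pselect (k = v) is right kv then old kv else inr u0.
have fv : f v = inr u0 by rewrite /f; case: pselect.
have f_old (a : set_type [set~ v]) : f (val a) = inl a.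
  by rewrite /f; case: pselect => [/old_neq//|av]; congr inl; apply: val_inj.
have vP (a : set_type [set~ v]) : adj v (val a) <-> val a = val u0.
  split=> [va|->]; last exact: clique_adj.
  by rewrite -(all_u0 (@elem _ (neighbors v) _ va)).
exists f.
  exists (fun x => if x is inl a then val a else v).
    by move=> k; rewrite /f; case: pselect => [->|kv].
  by move=> [a|u]; rewrite ?f_old// fv -(all_u0 u).
move=> x y; apply: (vertex_cases (v := v)
  (P := fun x => adj x y <-> adj (f x) (f y))) x => [|a];
  apply: (vertex_cases (v := v) (P := fun y => adj _ y <-> adj _ (f y))) y => [|b].
- by rewrite fv; split=> /adj_irrefl.
- by rewrite fv f_old vP.
- rewrite fv f_old /= -vP; split; exact: adj_sym.
- by rewrite !f_old.
Qed.

Theorem proposition1p21 (R : realType) (d : nat) (hd : (0 < d)%N)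
    (G : sgraph) (v : G) (hv : has_degree v d) :
  polytopal R d (star_clique v) <-> polytopal R d G.
Proof.
rewrite !polytopal_realizes; split=> -[w w_real]; last first.
  have [h [hv_lt0 h_gt0]] := truncating_hyperplane w_real v.
  by exists (truncation w h); apply: truncation_realizes.
have [d1|d1] := eqVneq d 1%N.
  have [f f_bij f_adj] : isograph G (star_clique v).
    by apply: star_clique1; rewrite -d1.
  by exists (w \o f); apply: realizes_isograph.
have d_gt1 : (1 < d)%N by rewrite ltn_neqAle eq_sym d1.
have [h hP] := clique_exposed d_gt1 hv w_real.
have /choice[e eP] := clique_facet d_gt1 hv w_real hP.
have [nb nb_bij] := degree_enum hv.
have [u0 _] := clique_nonempty d_gt1 hv.
exists (untruncation w h e u0).
exact: (untruncation_realizes d_gt1 hv w_real hP eP nb_bij).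
Qed.
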